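(* Let $\mathbf{k}$, $A$, $R$ be as in the context, let $V_\bullet$ be a finite-dimensional graded $\mathbf{k}$-vector space, and let $p\in\mathrm{Rep}_R(A,V_\bullet)$ be a $\mathbf{k}$-point, with corresponding graded MCM $A$-module $M_p$. Then there is an exact sequence of $\mathbf{k}$-vector spaces $$0\to \mathrm{End}_A(M_p)_0\to \mathrm{End}_R(V_\bullet\otimes R)_0\to T_p\,\mathrm{Rep}_R(A,V_\bullet)\to \mathrm{Ext}^1_A(M_p,M_p)_0\to 0 .$$
   Context: $\mathbf{k}$ is an algebraically closed field. $A=\bigoplus_{i\ge 0}A_i$ is a non-negatively graded (not necessarily commutative) $\mathbf{k}$-algebra that is module-finite over its center $Z(A)$, such that $Z(A)$ is a finitely generated $\mathbf{k}$-algebra and $A_0$ is finite dimensional over $\mathbf{k}$. $R\subset Z(A)$ is a graded polynomial subring (a polynomial ring over $\mathbf{k}$ on homogeneous variables, not necessarily standard graded) over which $A$ is module-finite. Unadorned tensor products are over $\mathbf{k}$. A graded maximal Cohen-Macaulay (MCM) $A$-module is a finitely generated graded left $A$-module whose restriction to $Z(A)$ is MCM; equivalently, it is free as a (graded) $R$-module. For a commutative $\mathbf{k}$-algebra $T$ (placed in degree $0$) put $A_T=T\otimes A$ and $R_T=T\otimes R$. $\mathrm{Rep}_R(A,V_\bullet)$ is the affine scheme of finite type over $\mathbf{k}$ representing the functor sending $T$ to the set of graded $A_T$-modules $M$ together with an isomorphism $V_\bullet\otimes R_T\to M$ of graded $R_T$-modules (up to isomorphisms compatible with the framings); equivalently,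 the set of graded $A_T$-module structures on $V_\bullet\otimes R_T$ extending its $R_T$-module structure. A $\mathbf{k}$-point $p$ is thus a graded $A$-module structure on $V_\bullet\otimes R$ extending the $R$-module structure, and $M_p$ denotes the resulting graded MCM $A$-module. $T_p$ denotes the Zariski tangent space at $p$ of this scheme. A subscript $0$ denotes the degree-zero part: $\mathrm{End}(\cdot)_0$ is the space of degree-preserving endomorphisms, and $\mathrm{Ext}^1_A(\cdot,\cdot)_0$ is the space of extension classes in the category of graded $A$-modules with degree-preserving maps. *)

(* Defs.v *)
From HB Require Import structures.
From mathcomp Require Import all_boot all_order all_algebra.
From mathcomp Require Import mpoly.
From mathcomp Require Import boolp functions.

Set Implicit Arguments.
Unset Strict Implicit.
Unset Printing Implicit Defensive.

Import GRing.Theory.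
Local Open Scope ring_scope.

(* M is the internal direct sum of the additive subgroups gr i.         *)

Record is_grading (I : eqType) (M : zmodType) (gr : I -> M -> Prop) : Prop :=
  IsGrading {
    gr_0 : forall i, gr i 0;
    gr_B : forall i x y, gr i x -> gr i y -> gr i (x - y);
    gr_span : forall x, exists (s : seq I) (f : I -> M),
      (forall i, gr i (f i)) /\ x = \sum_(i <- s) f i;
    gr_indep : forall (s : seq I) (f : I -> M), uniq s ->
      (forall i, gr i (f i)) -> \sum_(i <- s) f i = 0 ->
      forall i, i \in s -> f i = 0 }.

Section GradingTheory.
Variables (I : eqType) (M : zmodType) (gr : I -> M -> Prop).

Section Components.
Hypothesis hgr : is_grading gr.

Lemma gr_N i x : gr i x -> gr i (- x).
Proof. by move=> h; rewrite -sub0r; apply: (gr_B hgr) => //; exact: (gr_0 hgr). Qed.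

Lemma gr_D i x y : gr i x -> gr i y -> gr i (x + y).
Proof. by move=> hx /gr_N hy; rewrite -[y]opprK; apply: (gr_B hgr). Qed.

Lemma gr_sum i (J : Type) (s : seq J) (f : J -> M) :
  (forall j, gr i (f j)) -> gr i (\sum_(j <- s) f j).
Proof.
by move=> hf; elim/big_rec: _ => [|j x _ hx]; [exact: (gr_0 hgr)|exact: gr_D].
Qed.

Lemma comp_ex x : exists f : I -> M, (forall i, gr i (f i)) /\
  exists s : seq I, [/\ uniq s, forall i, i \notin s -> f i = 0
    & x = \sum_(i <- s) f i].
Proof.
have [s [f [hf ->]]] := gr_span hgr x.
exists (fun i => f i *+ count_mem i s); split.
  move=> i; elim: (count_mem i s) => [|n IHn]; first by rewrite mulr0n; exact: (gr_0 hgr).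
  by rewrite mulrS; apply: gr_D.
exists (undup s); split; first exact: undup_uniq.
  by move=> i; rewrite mem_undup => /count_memPn ->; rewrite mulr0n.
elim: s => [|i s IHs]; first by rewrite !big_nil.
rewrite big_cons {}IHs /=; case: ifPn => his.
  rewrite [RHS](bigD1_seq i) ?mem_undup ?undup_uniq //=.
  rewrite [in LHS](bigD1_seq i) ?mem_undup ?undup_uniq //= addrA eqxx.
  rewrite add1n mulrS; congr (_ + _); apply: eq_bigr => j hj.
  by rewrite eq_sym (negPf hj) add0n.
rewrite big_cons eqxx (count_memPn his) addn0 mulr1n; congr (_ + _).
rewrite big_seq [RHS]big_seq; apply: eq_bigr => j; rewrite mem_undup => hj.
by case: (eqVneq i j) his => [->|//]; rewrite hj.
Qed.

Definition comps x : I -> M := projT1 (cid (comp_ex x)).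
Definition comp i x : M := comps x i.

Lemma comp_gr i x : gr i (comp i x).
Proof. by rewrite /comp /comps; case: cid => f /= []. Qed.

Lemma comp_sum x : exists s : seq I,
  [/\ uniq s, forall i, i \notin s -> comp i x = 0
    & x = \sum_(i <- s) comp i x].
Proof. by rewrite /comp /comps; case: cid => f /= []. Qed.

Lemma big_sub (s t : seq I) (f : I -> M) : uniq s -> uniq t ->
  {subset s <= t} -> (forall i, i \notin s -> f i = 0) ->
  \sum_(i <- s) f i = \sum_(i <- t) f i.
Proof.
move=> us ut st f0; rewrite [RHS](bigID (mem s)) /= [X in _ = _ + X]big1 //.
rewrite addr0 -[RHS]big_filter; apply: perm_big; apply: uniq_perm => //.
  exact: filter_uniq.
by move=> i; rewrite mem_filter; case: (boolP (i \in s)) => // /st ->.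
Qed.

Lemma comp_uniq x (s : seq I) (f : I -> M) : uniq s ->
  (forall i, gr i (f i)) -> (forall i, i \notin s -> f i = 0) ->
  x = \sum_(i <- s) f i -> forall i, comp i x = f i.
Proof.
move=> us hf f0 xE i; have [t [ut c0 xE']] := comp_sum x.
pose u := undup (s ++ t).
have uu : uniq u by exact: undup_uniq.
have su : {subset s <= u} by move=> j hj; rewrite mem_undup mem_cat hj.
have tu : {subset t <= u} by move=> j hj; rewrite mem_undup mem_cat hj orbT.
have : \sum_(j <- u) (comp j x - f j) = 0.
  by rewrite sumrB -(big_sub us uu su f0) -(big_sub ut uu tu c0) -xE -xE' subrr.
move/(gr_indep hgr uu) => h.
have [iu|iu] := boolP (i \in u).
  apply/eqP; rewrite -subr_eq0; apply/eqP; apply: h => // j.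
  by apply: (gr_B hgr) => //; exact: comp_gr.
rewrite f0 ?c0 //; first by apply: contra iu => /tu.
by apply: contra iu => /su.
Qed.

Lemma comp_id i x : gr i x -> comp i x = x.
Proof.
move=> hx; rewrite (@comp_uniq x [:: i] (fun j => if j == i then x else 0)) ?eqxx //.
- by move=> j; case: eqP => [->|_] //; exact: (gr_0 hgr).
- by move=> j; rewrite inE => /negPf ->.
- by rewrite big_seq1 eqxx.
Qed.

Lemma comp_neq i j x : gr j x -> i != j -> comp i x = 0.
Proof.
move=> hx hij; rewrite (@comp_uniq x [:: j] (fun i => if i == j then x else 0)) ?(negPf hij) //.
- by move=> l; case: eqP => [->|_] //; exact: (gr_0 hgr).
- by move=> l; rewrite inE => /negPf ->.
- by rewrite big_seq1 eqxx.
Qed.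

Lemma compB i x y : comp i (x - y) = comp i x - comp i y.
Proof.
have [s [us s0 xE]] := comp_sum x; have [t [ut t0 yE]] := comp_sum y.
pose u := undup (s ++ t).
have uu : uniq u by exact: undup_uniq.
have su : {subset s <= u} by move=> j hj; rewrite mem_undup mem_cat hj.
have tu : {subset t <= u} by move=> j hj; rewrite mem_undup mem_cat hj orbT.
apply: (@comp_uniq _ u (fun i => comp i x - comp i y)) => //.
- by move=> j; apply: (gr_B hgr); exact: comp_gr.
- move=> j; rewrite mem_undup mem_cat negb_or => /andP[js jt].
  by rewrite s0 // t0 // subr0.
- by rewrite sumrB -(big_sub us uu su s0) -(big_sub ut uu tu t0) -xE -yE.
Qed.

Lemma comp0 i : comp i 0 = 0.
Proof. by rewrite -[X in comp _ X](subrr 0) compB subrr. Qed.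

Lemma compD i x y : comp i (x + y) = comp i x + comp i y.
Proof. by rewrite -{1}[y]opprK compB -[- y]sub0r compB comp0 sub0r opprK. Qed.

Lemma comp_sum_in x y : exists s : seq I, [/\ uniq s,
  x = \sum_(i <- s) comp i x & y = \sum_(i <- s) comp i y].
Proof.
have [s [us s0 xE]] := comp_sum x; have [t [ut t0 yE]] := comp_sum y.
exists (undup (s ++ t)); split; first exact: undup_uniq.
- rewrite {1}xE; apply: (big_sub us (undup_uniq _) _ s0) => j hj.
  by rewrite mem_undup mem_cat hj.
- rewrite {1}yE; apply: (big_sub ut (undup_uniq _) _ t0) => j hj.
  by rewrite mem_undup mem_cat hj orbT.
Qed.

End Components.

Lemma grading_of_comp (c : I -> M -> M) :
  (forall i, gr i 0) ->
  (forall i x y, gr i x -> gr i y -> gr i (x - y)) ->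
  (forall i x, gr i (c i x)) ->
  (forall i x y, c i (x + y) = c i x + c i y) ->
  (forall i x, gr i x -> c i x = x) ->
  (forall i j x, gr j x -> i != j -> c i x = 0) ->
  (forall x, exists s, x = \sum_(i <- s) c i x) ->
  is_grading gr.
Proof.
move=> h0 hB hc cD ci cn csum; split=> //.
  by move=> x; have [s xE] := csum x; exists s, (c^~ x).
move=> s f us hf sf0 i si.
have c0 j : c j 0 = 0 by apply: ci.
have : c i (\sum_(j <- s) f j) = f i.
  rewrite (big_morph (c i) (cD i) (c0 i)) (bigD1_seq i) //= (ci _ _ (hf i)).
  by rewrite big1 ?addr0 // => j hj; apply: (cn _ j) => //; rewrite eq_sym.
by rewrite sf0 c0 => <-.
Qed.

End GradingTheory.

Lemma comp_hom (I : eqType) (M N : zmodType) (gM : I -> M -> Prop)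
    (gN : I -> N -> Prop) (hM : is_grading gM) (hN : is_grading gN)
    (f : M -> N) :
  (forall x y, f (x + y) = f x + f y) ->
  (forall i x, gM i x -> gN i (f x)) ->
  forall i x, comp hN i (f x) = f (comp hM i x).
Proof.
move=> fD fgr i x; have [s [us s0 xE]] := comp_sum hM x.
have f0 : f 0 = 0 by apply: (addIr (f 0)); rewrite -fD !add0r.
apply: (@comp_uniq _ _ _ hN _ s (fun i => f (comp hM i x))) => //.
- by move=> j; apply: fgr; exact: comp_gr.
- by move=> j /s0 ->.
- by rewrite {1}xE (big_morph f fD f0).
Qed.

Record galg (k : fieldType) := GAlg {
  ga_alg :> algType k;
  ga_gr : nat -> ga_alg -> Prop;
  ga_grading : is_grading ga_gr;
  ga_Z : forall i (c : k) a, ga_gr i a -> ga_gr i (c *: a);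
  ga_1 : ga_gr 0%N 1;
  ga_M : forall i j a b, ga_gr i a -> ga_gr j b -> ga_gr (i + j)%N (a * b) }.

Record gmod (k : fieldType) (A : galg k) := GMod {
  gm_mod :> lmodType A;
  gm_gr : int -> gm_mod -> Prop;
  gm_grading : is_grading gm_gr;
  gm_act : forall (i : nat) (j : int) (a : A) x,
    ga_gr i a -> gm_gr j x -> gm_gr (i%:Z + j) (a *: x) }.

Section Homs.
Variables (k : fieldType) (A : galg k).
Implicit Types M N P : gmod A.

Definition is_ghom M N (f : M -> N) : Prop :=
  (forall (a : A) x y, f (a *: x + y) = a *: f x + f y) /\
  (forall i x, gm_gr i x -> gm_gr i (f x)).

(* Hom_A(M, N)_0.                                                       *)
Record ghom M N := GHom { gfun :> M -> N; ghomP : is_ghom gfun }.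

Lemma ghom_ext M N (f g : ghom M N) : f =1 g -> f = g.
Proof.
case: f g => f hf [g hg] /= /funext fg; move: hf hg; rewrite fg => hf hg.
by congr GHom; exact: Prop_irrelevance.
Qed.

Section Theory.
Variables (M N : gmod A) (f : ghom M N).

Lemma ghomD x y : f (x + y) = f x + f y.
Proof. by have [h _] := ghomP f; rewrite -[x]scale1r h !scale1r. Qed.
Lemma ghom0 : f 0 = 0.
Proof. by apply: (addIr (f 0)); rewrite -ghomD !add0r. Qed.
Lemma ghomZ a x : f (a *: x) = a *: f x.
Proof. by have [h _] := ghomP f; rewrite -[a *: x]addr0 h ghom0 addr0. Qed.
Lemma ghomN x : f (- x) = - f x.
Proof. by rewrite -scaleN1r ghomZ scaleN1r. Qed.
Lemma ghomB x y : f (x - y) = f x - f y.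
Proof. by rewrite ghomD ghomN. Qed.
Lemma ghom_gr i x : gm_gr i x -> gm_gr i (f x).
Proof. by have [_ h] := ghomP f => /h. Qed.
Lemma ghom_comp i x :
  comp (gm_grading N) i (f x) = f (comp (gm_grading M) i x).
Proof. by apply: comp_hom; [exact: ghomD|exact: ghom_gr]. Qed.
End Theory.

Lemma gm_0 M i : gm_gr i (0 : M).
Proof. exact: gr_0 (gm_grading M) i. Qed.
Lemma gm_D M i (x y : M) : gm_gr i x -> gm_gr i y -> gm_gr i (x + y).
Proof. exact: gr_D (gm_grading M) i x y. Qed.
Lemma gm_B M i (x y : M) : gm_gr i x -> gm_gr i y -> gm_gr i (x - y).
Proof. exact: gr_B (gm_grading M) i x y. Qed.
Lemma gm_N M i (x : M) : gm_gr i x -> gm_gr i (- x).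
Proof. exact: gr_N (gm_grading M) i x. Qed.
Lemma gm_Z M i (c : k) (x : M) : gm_gr i x -> gm_gr i ((c%:A : A) *: x).
Proof.
by move=> hx; rewrite -[i]add0r; apply: gm_act => //; apply: ga_Z; exact: ga_1.
Qed.

Lemma algZ_comm M (c : k) (a : A) (x : M) :
  (c%:A : A) *: (a *: x) = a *: ((c%:A : A) *: x).
Proof. by rewrite !scalerA mulr_algl mulr_algr. Qed.

(* k acts on a module through k -> A.                                   *)
Section HomSpace.
Variables (M N : gmod A).

Lemma ghom_zero_subproof : is_ghom (fun _ : M => 0 : N).
Proof. by split=> [a x y|i x _]; rewrite ?scaler0 ?addr0 //; exact: gm_0. Qed.
Definition ghom_zero := GHom ghom_zero_subproof.

Lemma ghom_add_subproof (f g : ghom M N) : is_ghom (fun x => f x + g x).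
Proof.
split=> [a x y|i x hx]; last by apply: gm_D; exact: ghom_gr.
by rewrite !ghomD !ghomZ scalerDr addrACA.
Qed.
Definition ghom_add f g := GHom (ghom_add_subproof f g).

Lemma ghom_opp_subproof (f : ghom M N) : is_ghom (fun x => - f x).
Proof.
split=> [a x y|i x hx]; last by apply: gm_N; exact: ghom_gr.
by rewrite ghomD ghomZ opprD scalerN.
Qed.
Definition ghom_opp f := GHom (ghom_opp_subproof f).

Lemma ghom_scale_subproof (c : k) (f : ghom M N) :
  is_ghom (fun x => (c%:A : A) *: f x).
Proof.
split=> [a x y|i x hx]; last by apply: gm_Z; exact: ghom_gr.
by rewrite ghomD ghomZ scalerDr algZ_comm.
Qed.
Definition ghom_scale c f := GHom (ghom_scale_subproof c f).

HB.instance Definition _ := gen_eqMixin (ghom M N).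
HB.instance Definition _ := gen_choiceMixin (ghom M N).

Lemma ghom_addA : associative ghom_add.
Proof. by move=> f g h; apply: ghom_ext => x /=; rewrite addrA. Qed.
Lemma ghom_addC : commutative ghom_add.
Proof. by move=> f g; apply: ghom_ext => x /=; rewrite addrC. Qed.
Lemma ghom_add0 : left_id ghom_zero ghom_add.
Proof. by move=> f; apply: ghom_ext => x /=; rewrite add0r. Qed.
Lemma ghom_addN : left_inverse ghom_zero ghom_opp ghom_add.
Proof. by move=> f; apply: ghom_ext => x /=; rewrite addNr. Qed.
HB.instance Definition _ := GRing.isZmodule.Build (ghom M N)
  ghom_addA ghom_addC ghom_add0 ghom_addN.

Lemma ghom_scaleA (c d : k) f :
  ghom_scale c (ghom_scale d f) = ghom_scale (c * d) f.
Proof. by apply: ghom_ext => x /=; rewrite scalerA mulr_algl scalerA. Qed.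
Lemma ghom_scale1 : left_id 1 ghom_scale.
Proof. by move=> f; apply: ghom_ext => x /=; rewrite !scale1r. Qed.
Lemma ghom_scaleDr : right_distributive ghom_scale +%R.
Proof. by move=> c f g; apply: ghom_ext => x /=; rewrite scalerDr. Qed.
Lemma ghom_scaleDl f :
  {morph ghom_scale^~ f : c d / c + d >-> c + d}.
Proof. by move=> c d; apply: ghom_ext => x /=; rewrite !scalerDl. Qed.
HB.instance Definition _ := GRing.Zmodule_isLmodule.Build k (ghom M N)
  ghom_scaleA ghom_scale1 ghom_scaleDr ghom_scaleDl.
End HomSpace.

Lemma ghom_id_subproof M : is_ghom (fun x : M => x).
Proof. by []. Qed.
Definition ghom_id M := GHom (ghom_id_subproof M).

Lemma ghom_compose_subproof M N P (g : ghom N P) (f : ghom M N) :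
  is_ghom (fun x => g (f x)).
Proof.
by split=> [a x y|i x hx]; rewrite ?ghomD ?ghomZ //; do 2!apply: ghom_gr.
Qed.
Definition ghom_compose M N P (g : ghom N P) (f : ghom M N) :=
  GHom (ghom_compose_subproof g f).

Section Product.
Variables M N : gmod A.
Definition gprod_gr (i : int) (x : M * N) := gm_gr i x.1 /\ gm_gr i x.2.

Lemma gprod_grading : is_grading gprod_gr.
Proof.
apply: (@grading_of_comp _ _ _ (fun i x =>
  (comp (gm_grading M) i x.1, comp (gm_grading N) i x.2))).
- by move=> i; split; exact: gm_0.
- by move=> i x y [? ?] [? ?]; split; apply: gm_B.
- by move=> i x; split; exact: comp_gr.
- by move=> i x y /=; rewrite !compD.
- by move=> i [x y] [/= hx hy]; rewrite !comp_id.
- move=> i j [x y] [/= hx hy] hij.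
  by rewrite (comp_neq (gm_grading M) hx hij) (comp_neq (gm_grading N) hy hij).
- move=> [x y].
  have [s [us s0 xE]] := comp_sum (gm_grading M) x.
  have [t [ut t0 yE]] := comp_sum (gm_grading N) y.
  have uu := undup_uniq (s ++ t).
  exists (undup (s ++ t)).
  have -> : forall u : seq int, \sum_(i <- u) (comp (gm_grading M) i x,
      comp (gm_grading N) i y) = (\sum_(i <- u) comp (gm_grading M) i x,
      \sum_(i <- u) comp (gm_grading N) i y) :> M * N.
    by elim=> [|i u IHu]; rewrite ?big_nil // !big_cons IHu.
  rewrite {1}xE {1}yE (big_sub us uu _ s0) ?(big_sub ut uu _ t0) // => i hi.
    by rewrite mem_undup mem_cat hi orbT.
  by rewrite mem_undup mem_cat hi.
Qed.

Lemma gprod_act (i : nat) (j : int) (a : A) (x : (M * N)%type) :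
  ga_gr i a -> gprod_gr j x -> gprod_gr (i%:Z + j) (a *: x).
Proof. by move=> ha [? ?]; split; apply: gm_act. Qed.

Definition gprod : gmod A := GMod gprod_grading gprod_act.

Lemma gfst_subproof : is_ghom (fun x : gprod => x.1 : M).
Proof. by split=> [//|i x []]. Qed.
Definition gfst : ghom gprod M := GHom gfst_subproof.
Lemma gsnd_subproof : is_ghom (fun x : gprod => x.2 : N).
Proof. by split=> [//|i x []]. Qed.
Definition gsnd : ghom gprod N := GHom gsnd_subproof.

Lemma gpair_subproof P (f : ghom P M) (g : ghom P N) :
  is_ghom (fun x => (f x, g x) : gprod).
Proof.
split=> [a x y|i x hx]; first by rewrite !ghomD !ghomZ.
by split; exact: ghom_gr.
Qed.
Definition gpair P (f : ghom P M) (g : ghom P N) : ghom P gprod :=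
  GHom (gpair_subproof f g).
End Product.

Section Kernel.
Variables (M N : gmod A) (f : ghom M N).

Definition gker_pred : {pred M} := fun x => f x == 0.
Lemma gker_submod : submod_closed gker_pred.
Proof.
split=> [|a x y]; rewrite !unfold_in ?ghom0 // => /eqP hx /eqP hy.
by rewrite ghomD ghomZ hx hy scaler0 addr0.
Qed.
HB.instance Definition _ :=
  GRing.isSubmodClosed.Build A M gker_pred gker_submod.

Record gker_type := GKerType { gker_val : M; _ : gker_val \in gker_pred }.
HB.instance Definition _ := [isSub for gker_val].
HB.instance Definition _ := [Choice of gker_type by <:].
HB.instance Definition _ := [SubChoice_isSubLmodule of gker_type by <:].

Lemma gker_valP (x : gker_type) : f (gker_val x) = 0.
Proof. by case: x => x /= /eqP. Qed.

Definition gker_gr (i : int) (x : gker_type) := gm_gr i (gker_val x).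

Lemma gker_comp_subproof i (x : gker_type) :
  comp (gm_grading M) i (gker_val x) \in gker_pred.
Proof. by rewrite unfold_in -ghom_comp gker_valP comp0. Qed.
Definition gker_comp i x := GKerType (gker_comp_subproof i x).

Lemma gker_grading : is_grading gker_gr.
Proof.
apply: (@grading_of_comp _ _ _ gker_comp).
- by move=> i; exact: gm_0.
- by move=> i x y; exact: gm_B.
- by move=> i x; exact: comp_gr.
- by move=> i x y; apply: val_inj; exact: compD.
- by move=> i x hx; apply: val_inj; exact: comp_id.
- by move=> i j x hx hij; apply: val_inj; exact: (@comp_neq _ _ _ (gm_grading M) i j (gker_val x)).
- move=> x; have [s [us s0 xE]] := comp_sum (gm_grading M) (val x).
  by exists s; apply: val_inj; rewrite raddf_sum.
Qed.

Lemma gker_act (i : nat) (j : int) (a : A) (x : gker_type) :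
  ga_gr i a -> gker_gr j x -> gker_gr (i%:Z + j) (a *: x).
Proof. exact: gm_act. Qed.

Definition gker : gmod A := GMod gker_grading gker_act.

Lemma gker_incl_subproof : is_ghom (fun x : gker => gker_val x : M).
Proof. by split. Qed.
Definition gker_incl : ghom gker M := GHom gker_incl_subproof.

Lemma gker_lift_subproof1 P (g : ghom P M) (h : forall x, f (g x) = 0) x :
  g x \in gker_pred.
Proof. by rewrite unfold_in h. Qed.
Lemma gker_lift_subproof2 P (g : ghom P M) (h : forall x, f (g x) = 0) :
  is_ghom (fun x => GKerType (gker_lift_subproof1 h x) : gker).
Proof.
split=> [a x y|i x hx]; last exact: ghom_gr.
by apply: val_inj; rewrite /= ghomD ghomZ.
Qed.
Definition gker_lift P (g : ghom P M) (h : forall x, f (g x) = 0) :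
  ghom P gker := GHom (gker_lift_subproof2 h).
End Kernel.

Section Cokernel.
Variables (M N : gmod A) (f : ghom M N).

Definition gimg_pred : {pred N} := fun y => `[< exists x, y = f x >].
Lemma gimg_zmod : zmod_closed gimg_pred.
Proof.
split=> [|y z]; rewrite !unfold_in.
  by apply/asboolP; exists 0; rewrite ghom0.
move=> /asboolP[u ->] /asboolP[v ->]; apply/asboolP.
by exists (u - v); rewrite ghomB.
Qed.
HB.instance Definition _ := GRing.isZmodClosed.Build N gimg_pred gimg_zmod.

Definition gcok_type : Type := {ideal_quot gimg_pred}.
HB.instance Definition _ := GRing.Zmodule.on gcok_type.
Local Notation Q := gcok_type.

Definition gcok_pi (y : N) : Q := \pi_{ideal_quot gimg_pred}%qT y.

Lemma gcok_piE y z : gcok_pi y = gcok_pi z <-> exists x, y - z = f x.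
Proof.
split=> [/eqP|[x h]].
  by rewrite /gcok_pi -Quotient.idealrBE unfold_in => /asboolP.
by apply/eqP; rewrite /gcok_pi -Quotient.idealrBE unfold_in; apply/asboolP; exists x.
Qed.
Lemma gcok_piD y z : gcok_pi (y + z) = gcok_pi y + gcok_pi z.
Proof. by rewrite /gcok_pi raddfD. Qed.
Lemma gcok_reprK (y : Q) : gcok_pi (repr y) = y.
Proof. exact: reprK. Qed.

Definition gcok_scale (a : A) (y : Q) := gcok_pi (a *: repr y).
Lemma gcok_piZ a y : gcok_pi (a *: y) = gcok_scale a (gcok_pi y).
Proof.
apply/gcok_piE; have /gcok_piE[x h] : gcok_pi y = gcok_pi (repr (gcok_pi y)).
  by rewrite gcok_reprK.
by exists (a *: x); rewrite ghomZ -h scalerBr.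
Qed.

Lemma gcok_scaleA a b (y : Q) :
  gcok_scale a (gcok_scale b y) = gcok_scale (a * b) y.
Proof. by rewrite -[y]gcok_reprK -!gcok_piZ scalerA. Qed.
Lemma gcok_scale1 : left_id 1 gcok_scale.
Proof. by move=> y; rewrite -[y]gcok_reprK -!gcok_piZ scale1r. Qed.
Lemma gcok_scaleDr : right_distributive gcok_scale +%R.
Proof.
move=> a y z; rewrite -[y]gcok_reprK -[z]gcok_reprK.
by rewrite -gcok_piD -!gcok_piZ scalerDr gcok_piD.
Qed.
Lemma gcok_scaleDl y : {morph gcok_scale^~ y : a b / a + b >-> a + b}.
Proof.
by move=> a b; rewrite -[y]gcok_reprK -!gcok_piZ scalerDl gcok_piD.
Qed.
HB.instance Definition _ := GRing.Zmodule_isLmodule.Build A Q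
  gcok_scaleA gcok_scale1 gcok_scaleDr gcok_scaleDl.

Definition gcok_gr (i : int) (y : Q) := exists2 z, gm_gr i z & y = gcok_pi z.

Definition gcok_comp i (y : Q) := gcok_pi (comp (gm_grading N) i (repr y)).
Lemma gcok_compE i y :
  gcok_comp i (gcok_pi y) = gcok_pi (comp (gm_grading N) i y).
Proof.
apply/gcok_piE; have /gcok_piE[x h] : gcok_pi (repr (gcok_pi y)) = gcok_pi y.
  by rewrite gcok_reprK.
by exists (comp (gm_grading M) i x); rewrite -ghom_comp -h compB.
Qed.

Lemma gcok_grading : is_grading gcok_gr.
Proof.
apply: (@grading_of_comp _ _ _ gcok_comp).
- by move=> i; exists 0; [exact: gm_0|rewrite /gcok_pi raddf0].
- move=> i x y [u hu ->] [v hv ->]; exists (u - v); first exact: gm_B.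
  by rewrite /gcok_pi raddfB.
- by move=> i x; exists (comp (gm_grading N) i (repr x)) => //; exact: comp_gr.
- move=> i x y; rewrite -[x]gcok_reprK -[y]gcok_reprK.
  by rewrite -gcok_piD !gcok_compE compD gcok_piD.
- by move=> i _ [u hu ->]; rewrite gcok_compE comp_id.
- move=> i j _ [u hu ->] hij; rewrite gcok_compE (comp_neq _ hu hij).
  by rewrite /gcok_pi raddf0.
- move=> x; have [s [us s0 xE]] := comp_sum (gm_grading N) (repr x).
  exists s; rewrite -{1}[x]gcok_reprK xE /gcok_pi raddf_sum.
  by [].
Qed.

Lemma gcok_act (i : nat) (j : int) (a : A) (x : Q) :
  ga_gr i a -> gcok_gr j x -> gcok_gr (i%:Z + j) (a *: x).
Proof.
move=> ha [u hu ->]; exists (a *: u); first exact: gm_act.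
by rewrite gcok_piZ.
Qed.

Definition gcok : gmod A := GMod gcok_grading gcok_act.

Lemma gcok_proj_subproof : is_ghom (gcok_pi : N -> gcok).
Proof.
split=> [a x y|i x hx]; first by rewrite gcok_piD gcok_piZ.
by exists x.
Qed.
Definition gcok_proj : ghom N gcok := GHom gcok_proj_subproof.

Section Desc.
Variables (P : gmod A) (g : ghom N P) (h : forall x, g (f x) = 0).
Definition gcok_desc_fun (y : gcok) : P := g (repr (y : Q)).
Lemma gcok_desc_funE y : gcok_desc_fun (gcok_proj y) = g y.
Proof.
have /gcok_piE[x e] : gcok_pi (repr (gcok_pi y)) = gcok_pi y.
  by rewrite gcok_reprK.
apply/eqP; rewrite -subr_eq0 -ghomB.
by rewrite [X in g X]e h.
Qed.
Lemma gcok_surj (y : gcok) : exists z, y = gcok_proj z.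
Proof. by exists (repr (y : Q)); rewrite /= gcok_reprK. Qed.
Lemma gcok_desc_subproof : is_ghom gcok_desc_fun.
Proof.
split=> [a x y|i x [z hz ->]]; last first.
  by rewrite [gcok_desc_fun _]gcok_desc_funE; exact: ghom_gr.
have [x' ->] := gcok_surj x; have [y' ->] := gcok_surj y.
by rewrite -ghomZ -ghomD !gcok_desc_funE ghomD ghomZ.
Qed.
Definition gcok_desc : ghom gcok P := GHom gcok_desc_subproof.
Lemma gcok_descE y : gcok_desc (gcok_proj y) = g y.
Proof. exact: gcok_desc_funE. Qed.
End Desc.
End Cokernel.

End Homs.

Section Pullback.
Variables (k : fieldType) (A : galg k).
Variables (X Y Z : gmod A) (f : ghom X Z) (g : ghom Y Z).

Definition gpb_diff : ghom (gprod X Y) Z :=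
  ghom_compose f (gfst X Y) - ghom_compose g (gsnd X Y).
Definition gpb : gmod A := gker gpb_diff.
Definition gpb1 : ghom gpb X := ghom_compose (gfst X Y) (gker_incl gpb_diff).
Definition gpb2 : ghom gpb Y := ghom_compose (gsnd X Y) (gker_incl gpb_diff).

Lemma gpbE (p : gpb) : f (gpb1 p) = g (gpb2 p).
Proof. by apply/eqP; rewrite -subr_eq0; apply/eqP; exact: (gker_valP p). Qed.

Lemma gpb_inj (p q : gpb) : gpb1 p = gpb1 q -> gpb2 p = gpb2 q -> p = q.
Proof.
move=> h1 h2; apply: val_inj; rewrite /= [LHS]surjective_pairing.
by rewrite [RHS]surjective_pairing; congr pair.
Qed.

Lemma gpb_mk_subproof x y : f x = g y -> (x, y) \in gker_pred gpb_diff.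
Proof. by move=> h; rewrite unfold_in /= h subrr. Qed.
Definition gpb_mk x y (h : f x = g y) : gpb := GKerType (gpb_mk_subproof h).

Lemma gpb_lift_subproof P (u : ghom P X) (v : ghom P Y) :
  (forall p, f (u p) = g (v p)) -> forall p, gpb_diff (gpair u v p) = 0.
Proof. by move=> h p; rewrite /= h subrr. Qed.
Definition gpb_lift P (u : ghom P X) (v : ghom P Y)
  (h : forall p, f (u p) = g (v p)) : ghom P gpb :=
  gker_lift (gpb_lift_subproof h).
End Pullback.

Section Extensions.
Variables (k : fieldType) (A : galg k) (N M : gmod A).

(* Short exact sequences 0 -> M -> E -> N -> 0.                         *)
Record ext := MkExt {
  ex_mid :> gmod A;
  ex_in : ghom M ex_mid;
  ex_pr : ghom ex_mid N;
  ex_inj : injective ex_in;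
  ex_surj : forall n, exists e, ex_pr e = n;
  ex_exact : forall e, ex_pr e = 0 <-> exists m, e = ex_in m }.

(* Such a map is automatically an isomorphism (five lemma).             *)
Definition ext_eqv (E F : ext) : Prop := exists phi : ghom E F,
  (forall m, phi (ex_in E m) = ex_in F m) /\
  (forall e, ex_pr F (phi e) = ex_pr E e).

Lemma ex_pr_in (E : ext) m : ex_pr E (ex_in E m) = 0.
Proof. by apply/ex_exact; exists m. Qed.

Lemma ghom_factor (P E F : gmod A) (f : ghom P E) (g : ghom P F) :
  (forall e, exists p, f p = e) -> (forall p, f p = 0 -> g p = 0) ->
  exists h : ghom E F, forall p, h (f p) = g p.
Proof.
move=> fs fg; have fg' p q : f p = f q -> g p = g q.
  move=> e; apply/eqP; rewrite -subr_eq0 -ghomB; apply/eqP/fg.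
  by rewrite ghomB e subrr.
have [s sK] := choice fs; pose h e := g (s e).
have hE p : h (f p) = g p by apply: fg'; rewrite sK.
suff hh : is_ghom h by exists (GHom hh).
split=> [a x y|i x hx].
  by rewrite -[x]sK -[y]sK -ghomZ -ghomD !hE ghomD ghomZ.
rewrite -(comp_id (gm_grading E) hx) -[x]sK ghom_comp hE.
by apply: ghom_gr; exact: comp_gr.
Qed.

Lemma ext_dom P (E F : ext) (f : ghom P E) (g : ghom P F) :
  (forall p, ex_pr E (f p) = ex_pr F (g p)) ->
  (forall n, exists p, ex_pr E (f p) = n) ->
  (forall p m, f p = ex_in E m -> g p = ex_in F m) ->
  ext_eqv E F.
Proof.
move=> prE fs h.
pose f' : ghom (gprod P M) E :=
  ghom_compose f (gfst P M) + ghom_compose (ex_in E) (gsnd P M).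
pose g' : ghom (gprod P M) F :=
  ghom_compose g (gfst P M) + ghom_compose (ex_in F) (gsnd P M).
have f's e : exists p, f' p = e.
  have [p hp] := fs (ex_pr E e).
  have /ex_exact[m hm] : ex_pr E (e - f p) = 0 by rewrite ghomB hp subrr.
  by exists (p, m); rewrite /= -hm addrC subrK.
have fg' p : f' p = 0 -> g' p = 0.
  case: p => p m /= /eqP; rewrite addr_eq0 -ghomN => /eqP /h ->.
  by rewrite ghomN addNr.
have [phi phiE] := ghom_factor f's fg'.
have f'0 m : f' (0, m) = ex_in E m by rewrite /= ghom0 add0r.
have g'0 m : g' (0, m) = ex_in F m by rewrite /= ghom0 add0r.
exists phi; split=> [m|e]; first by rewrite -f'0 phiE g'0.
have [[p m] <-] := f's e; rewrite phiE /= !ghomD !ex_pr_in !addr0.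
by rewrite prE.
Qed.

Lemma ext_eqv_refl E : ext_eqv E E.
Proof. by exists (ghom_id E). Qed.

Lemma ext_eqv_sym E F : ext_eqv E F -> ext_eqv F E.
Proof.
move=> [f [f1 f2]]; apply: (@ext_dom E F E f (ghom_id E)) => //=.
- by move=> n; have [e he] := ex_surj E n; exists e; rewrite f2.
- move=> e m h.
  have /ex_exact[m' e'] : ex_pr E e = 0 by rewrite -f2 h ex_pr_in.
  by rewrite e'; congr (ex_in E _); apply: (@ex_inj F); rewrite -f1 -e'.
Qed.

Lemma ext_eqv_trans F E G : ext_eqv E F -> ext_eqv F G -> ext_eqv E G.
Proof.
move=> [f [f1 f2]] [g [g1 g2]]; exists (ghom_compose g f).
by split=> [m|e] /=; rewrite ?f1 ?g1 ?g2 ?f2.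
Qed.

Definition ext_split_in : ghom M (gprod M N) :=
  gpair (ghom_id M) (0 : ghom M N).
Lemma ext_split_inj : injective ext_split_in.
Proof. by move=> x y []. Qed.
Lemma ext_split_surj n : exists e, gsnd M N e = n.
Proof. by exists (0, n). Qed.
Lemma ext_split_exact e :
  gsnd M N e = 0 <-> exists m, e = ext_split_in m.
Proof.
by case: e => m n /=; split=> [->|[m' [_ ->]]] //; exists m.
Qed.
Definition ext_split : ext :=
  MkExt ext_split_inj ext_split_surj ext_split_exact.

(* c . E is the pullback of E along multiplication by c on N.           *)
Section Scale.
Variables (c : k) (E : ext).
Definition ext_scale_pr1 := gpb1 (ex_pr E) (c *: ghom_id N).
Definition ext_scale_pr := gpb2 (ex_pr E) (c *: ghom_id N).
Lemma ext_scale_in_subproof m :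
  ex_pr E (ex_in E m) = (c *: ghom_id N) ((0 : ghom M N) m).
Proof. by rewrite ex_pr_in ghom0. Qed.
Definition ext_scale_in := gpb_lift ext_scale_in_subproof.

Lemma ext_scale_inj : injective ext_scale_in.
Proof. by move=> x y /(congr1 ext_scale_pr1) /ex_inj. Qed.
Lemma ext_scale_surj n : exists e, ext_scale_pr e = n.
Proof.
have [e he] := ex_surj E ((c *: ghom_id N) n).
by exists (gpb_mk he).
Qed.
Lemma ext_scale_inE p m :
  p = ext_scale_in m <-> ext_scale_pr1 p = ex_in E m /\ ext_scale_pr p = 0.
Proof. by split=> [->|[h1 h2]] //; apply: gpb_inj. Qed.
Lemma ext_scale_exact p :
  ext_scale_pr p = 0 <-> exists m, p = ext_scale_in m.
Proof.
split=> [h|[m /ext_scale_inE[]] //].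
have /ex_exact[m hm] : ex_pr E (ext_scale_pr1 p) = 0.
  by rewrite (gpbE p) [gpb2 _ _ p]h ghom0.
by exists m; apply/ext_scale_inE.
Qed.
Definition ext_scale : ext :=
  MkExt ext_scale_inj ext_scale_surj ext_scale_exact.
End Scale.

(* Baer sum: the quotient of E x_N F by the antidiagonal copy of M.     *)
Section Baer.
Variables (E F : ext).
Local Notation P := (gpb (ex_pr E) (ex_pr F)).
Local Notation pr1 := (gpb1 (ex_pr E) (ex_pr F)).
Local Notation pr2 := (gpb2 (ex_pr E) (ex_pr F)).

Lemma baer_anti_subproof m :
  ex_pr E (ex_in E m) = ex_pr F ((- ex_in F : ghom M F) m).
Proof. by rewrite /= ghomN !ex_pr_in oppr0. Qed.
Definition baer_anti : ghom M P := gpb_lift baer_anti_subproof.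

Definition baer_proj : ghom P (gcok baer_anti) := gcok_proj baer_anti.

Lemma baer_pr_subproof m : ghom_compose (ex_pr E) pr1 (baer_anti m) = 0.
Proof. exact: ex_pr_in. Qed.
Definition baer_pr : ghom (gcok baer_anti) N := gcok_desc baer_pr_subproof.

Lemma baer_inl_subproof m :
  ex_pr E (ex_in E m) = ex_pr F ((0 : ghom M F) m).
Proof. by rewrite /= ex_pr_in ghom0. Qed.
Definition baer_in : ghom M (gcok baer_anti) :=
  ghom_compose baer_proj (gpb_lift baer_inl_subproof).

Lemma baer_prE p : baer_pr (baer_proj p) = ex_pr E (pr1 p).
Proof. exact: gcok_descE. Qed.

Lemma baer_inE p m : baer_proj p = baer_in m <->
  exists m1 m2, [/\ pr1 p = ex_in E m1, pr2 p = ex_in F m2 & m = m1 + m2].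
Proof.
split=> [/gcok_piE[x hx]|[m1 [m2 [h1 h2 ->]]]].
  have {}hx : p = baer_anti x + gpb_lift baer_inl_subproof m.
    by rewrite -hx subrK.
  exists (x + m), (- x); rewrite hx !ghomD; split.
  - by [].
  - by rewrite ghomN -[RHS]addr0.
  - by rewrite addrC addKr.
apply/gcok_piE; exists (- m2); apply: gpb_inj; rewrite ghomB.
  rewrite h1 -[gpb1 _ _ _]/(ex_in E (m1 + m2)) -ghomB.
  by congr (ex_in E _); rewrite opprD addrA subrr add0r.
by rewrite h2 -[gpb2 _ _ _]/(0 : F) subr0 -[RHS]/(- ex_in F (- m2)) ghomN opprK.
Qed.

Lemma baer_inj : injective baer_in.
Proof.
move=> x y; rewrite {1}/baer_in => /baer_inE[m1 [m2 [h1 h2 ->]]].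
have -> : m2 = 0 by apply: (@ex_inj F); rewrite -h2 ghom0.
by rewrite addr0; apply: (@ex_inj E); rewrite -h1.
Qed.
Lemma baer_surj n : exists e, baer_pr e = n.
Proof.
have [e he] := ex_surj E n; have [f hf] := ex_surj F n.
have h : ex_pr E e = ex_pr F f by rewrite he hf.
by exists (baer_proj (gpb_mk h)); rewrite baer_prE.
Qed.
Lemma baer_exact e : baer_pr e = 0 <-> exists m, e = baer_in m.
Proof.
have [p ->] : exists p, e = baer_proj p by exact: gcok_surj.
rewrite baer_prE; split=> [h|[m /baer_inE[m1 [m2 [-> _ _]]]]]; last first.
  exact: ex_pr_in.
have /ex_exact[m1 h1] := h.
have /ex_exact[m2 h2] : ex_pr F (pr2 p) = 0 by rewrite -(gpbE p).
by exists (m1 + m2); apply/baer_inE; exists m1, m2.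
Qed.
Definition baer_sum : ext := MkExt baer_inj baer_surj baer_exact.
Definition baer_pi : ghom P baer_sum := baer_proj.
End Baer.

Lemma baer_sum_cong E E' F F' : ext_eqv E E' -> ext_eqv F F' ->
  ext_eqv (baer_sum E F) (baer_sum E' F').
Proof.
move=> [f [f1 f2]] [g [g1 g2]].
pose u := ghom_compose f (gpb1 (ex_pr E) (ex_pr F)).
pose v := ghom_compose g (gpb2 (ex_pr E) (ex_pr F)).
have h p : ex_pr E' (u p) = ex_pr F' (v p) by rewrite /= f2 g2 (gpbE p).
apply: (ext_dom (f := baer_pi E F)
  (g := ghom_compose (baer_pi E' F') (gpb_lift h))).
- by move=> p; rewrite [LHS]baer_prE [RHS]baer_prE -f2.
- move=> n; have [e he] := ex_surj E n; have [e' he'] := ex_surj F n.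
  have h' : ex_pr E e = ex_pr F e' by rewrite he he'.
  by exists (gpb_mk h'); rewrite [LHS]baer_prE.
- move=> p m /baer_inE[m1 [m2 [h1 h2 ->]]]; apply/baer_inE; exists m1, m2.
  split=> //; first by rewrite -f1 -h1.
  by rewrite -g1 -h2.
Qed.

Lemma ext_scale_cong c E E' : ext_eqv E E' ->
  ext_eqv (ext_scale c E) (ext_scale c E').
Proof.
move=> [f [f1 f2]].
pose u := ghom_compose f (ext_scale_pr1 c E).
have h p : ex_pr E' (u p) = (c *: ghom_id N) (ext_scale_pr c E p).
  by rewrite [u p]/= f2 (gpbE p).
exists (gpb_lift h : ghom (ext_scale c E) (ext_scale c E')); split=> [m|e].
  by apply: gpb_inj => //; exact: f1.
by [].
Qed.

Lemma baer_sumC E F : ext_eqv (baer_sum E F) (baer_sum F E).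
Proof.
have h p : ex_pr F (gpb2 (ex_pr E) (ex_pr F) p) = ex_pr E (gpb1 _ _ p).
  by rewrite (gpbE p).
apply: (ext_dom (f := baer_pi E F)
  (g := ghom_compose (baer_pi F E) (gpb_lift h))).
- by move=> p; rewrite [LHS]baer_prE [RHS]baer_prE (gpbE p).
- by move=> n; have [e he] := ex_surj (baer_sum E F) n;
    have [p hp] := gcok_surj e; exists p; rewrite -he hp.
- move=> p m /baer_inE[m1 [m2 [h1 h2 ->]]]; apply/baer_inE; exists m2, m1.
  by rewrite addrC.
Qed.

Lemma baer_sumA E F G :
  ext_eqv (baer_sum E (baer_sum F G)) (baer_sum (baer_sum E F) G).
Proof.
pose q : ghom (gpb (ex_pr E) (ex_pr F)) N := ghom_compose (ex_pr E) (gpb1 _ _).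
pose P := gpb q (ex_pr G).
pose e : ghom P E := ghom_compose (gpb1 _ _) (gpb1 _ _).
pose f : ghom P F := ghom_compose (gpb2 _ _) (gpb1 _ _).
pose g : ghom P G := gpb2 _ _.
have hef p : ex_pr E (e p) = ex_pr F (f p) by exact: gpbE.
have heg p : ex_pr E (e p) = ex_pr G (g p) by exact: (gpbE p).
have hfg p : ex_pr F (f p) = ex_pr G (g p) by rewrite -hef.
pose fg := ghom_compose (baer_pi F G) (gpb_lift hfg).
pose ef := ghom_compose (baer_pi E F) (gpb_lift hef).
have h1 p : ex_pr E (e p) = ex_pr (baer_sum F G) (fg p).
  by rewrite [RHS]baer_prE; exact: hef.
have h2 p : ex_pr (baer_sum E F) (ef p) = ex_pr G (g p).
  by rewrite [LHS]baer_prE; exact: heg.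
apply: (ext_dom (f := ghom_compose (baer_pi _ _) (gpb_lift h1))
  (g := ghom_compose (baer_pi _ _) (gpb_lift h2))).
- by move=> p; rewrite [LHS]baer_prE [RHS]baer_prE [RHS]baer_prE.
- move=> n; have [x hx] := ex_surj E n; have [y hy] := ex_surj F n.
  have [z hz] := ex_surj G n.
  have hxy : ex_pr E x = ex_pr F y by rewrite hx hy.
  have hxz : q (gpb_mk hxy) = ex_pr G z by rewrite hz.
  by exists (gpb_mk hxz); rewrite [LHS]baer_prE.
- move=> p m /baer_inE[m1 [m' [e1 /baer_inE[m2 [m3 [e2 e3 ->]]] ->]]].
  apply/baer_inE; exists (m1 + m2), m3; split; rewrite ?addrA //.
  by apply/baer_inE; exists m1, m2.
Qed.

Lemma baer_sum0 E : ext_eqv (baer_sum ext_split E) E.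
Proof.
pose P := gpb (ex_pr ext_split) (ex_pr E).
pose g : ghom P E := ghom_compose (ex_in E)
  (ghom_compose (gfst M N) (gpb1 _ _)) + gpb2 _ _.
apply: (ext_dom (f := baer_pi ext_split E) (g := g)).
- by move=> p; rewrite [LHS]baer_prE ghomD ex_pr_in add0r (gpbE p).
- by move=> n; have [e he] := ex_surj (baer_sum ext_split E) n;
    have [p hp] := gcok_surj e; exists p; rewrite -he hp.
- move=> p m /baer_inE[m1 [m2 [h1 h2 ->]]].
  have -> : g p = ex_in E (gpb1 _ _ p).1 + gpb2 _ _ p by [].
  by rewrite h1 h2 ghomD.
Qed.

Lemma baer_sumN E : ext_eqv (baer_sum (ext_scale (-1) E) E) ext_split.
Proof.
pose P := gprod E M; pose e : ghom P E := gfst E M.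
have h1 p : ex_pr E ((- e) p) = (-1 *: ghom_id N) ((ghom_compose (ex_pr E) e) p).
  by rewrite /= scaleN1r scaleNr scale1r ghomN.
pose u : ghom P (ext_scale (-1) E) := gpb_lift h1.
have h2 p : ex_pr (ext_scale (-1) E) (u p) = ex_pr E (e p) by [].
pose f : ghom P (baer_sum (ext_scale (-1) E) E) :=
  ghom_compose (baer_pi _ _) (gpb_lift h2)
  + ghom_compose (ex_in _) (gsnd E M).
pose g : ghom P ext_split := gpair (gsnd E M) (ghom_compose (ex_pr E) e).
apply: (ext_dom (f := f) (g := g)).
- move=> p; rewrite [LHS]ghomD ex_pr_in addr0 [LHS]baer_prE.
  by [].
- move=> n; have [x hx] := ex_surj E n; exists (x, 0).
  by rewrite [LHS]ghomD ex_pr_in addr0 [LHS]baer_prE.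
- move=> [x m'] m /(canRL (addrK _)).
  rewrite -[X in _ = _ - X]/(ex_in _ m') -ghomB => /baer_inE[m1 [m2 [e1 e2 e3]]].
  have {}e1 : - x = ex_in E m1 by have [] := (ext_scale_inE _ m1).1 e1.
  have {}e2 : x = ex_in E m2 by [].
  have m0 : m1 + m2 = 0.
    by apply: (@ex_inj E); rewrite ghomD -e1 -e2 addNr ghom0.
  have -> : m = m' by apply/eqP; rewrite -subr_eq0 e3 m0.
  have -> : g (x, m') = (m', ex_pr E x) by [].
  by rewrite e2 ex_pr_in.
Qed.

Lemma ext_scaleA c d E :
  ext_eqv (ext_scale c (ext_scale d E)) (ext_scale (c * d) E).
Proof.
apply: ext_eqv_sym; pose P : gmod A := ext_scale (c * d) E.
pose n : ghom P N := ext_scale_pr (c * d) E.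
pose e : ghom P E := ext_scale_pr1 (c * d) E.
have h1 p : ex_pr E (e p) = (d *: ghom_id N) ((c *: n) p).
  rewrite [LHS](gpbE p) /= scalerA; congr (_ *: _).
  by rewrite mulr_algl scalerA mulrC.
pose u : ghom P (ext_scale d E) := gpb_lift h1.
have h2 p : ex_pr (ext_scale d E) (u p) = (c *: ghom_id N) (n p) by [].
exists (gpb_lift h2); split=> [m|//].
apply/ext_scale_inE; split=> //; apply/ext_scale_inE; split=> //.
by rewrite -[LHS]/(c%:A *: 0) scaler0.
Qed.

Lemma ext_scale1 E : ext_eqv (ext_scale 1 E) E.
Proof.
exists (ext_scale_pr1 1 E); split=> [m|e]; first by [].
rewrite [LHS](gpbE e) /= scale1r; exact: scale1r.
Qed.

Lemma ext_scaleDr c E F : ext_eqv (ext_scale c (baer_sum E F))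
  (baer_sum (ext_scale c E) (ext_scale c F)).
Proof.
pose q : ghom (gpb (ex_pr E) (ex_pr F)) N := ghom_compose (ex_pr E) (gpb1 _ _).
pose P := gpb q (c *: ghom_id N).
pose e : ghom P E := ghom_compose (gpb1 _ _) (gpb1 _ _).
pose f : ghom P F := ghom_compose (gpb2 _ _) (gpb1 _ _).
pose n : ghom P N := gpb2 _ _.
have he p : ex_pr E (e p) = (c *: ghom_id N) (n p) by exact: (gpbE p).
have hf p : ex_pr F (f p) = (c *: ghom_id N) (n p).
  by rewrite -he; apply/esym; exact: gpbE.
pose u : ghom P (baer_sum E F) := ghom_compose (baer_pi E F) (gpb1 _ _).
have hu p : ex_pr (baer_sum E F) (u p) = (c *: ghom_id N) (n p).
  by rewrite [LHS]baer_prE; exact: he.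
pose e' : ghom P (ext_scale c E) := gpb_lift he.
pose f' : ghom P (ext_scale c F) := gpb_lift hf.
have hef p : ex_pr (ext_scale c E) (e' p) = ex_pr (ext_scale c F) (f' p) by [].
apply: (ext_dom (E := ext_scale c (baer_sum E F)) (f := gpb_lift hu)
  (g := ghom_compose (baer_pi _ _) (gpb_lift hef))).
- by move=> p; rewrite [RHS]baer_prE.
- move=> m; have [x hx] := ex_surj E (c%:A *: m).
  have [y hy] := ex_surj F (c%:A *: m).
  have hxy : ex_pr E x = ex_pr F y by rewrite hx hy.
  by exists (gpb_mk (hx : q (gpb_mk hxy) = (c *: ghom_id N) m)).
- move=> p m /ext_scale_inE[/baer_inE[m1 [m2 [e1 e2 ->]]] n0].
  by apply/baer_inE; exists m1, m2; split=> //; apply/ext_scale_inE.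
Qed.

Lemma ext_scaleDl c d E : ext_eqv (ext_scale (c + d) E)
  (baer_sum (ext_scale c E) (ext_scale d E)).
Proof.
pose P := gpb (ex_pr (ext_scale c E)) (ex_pr (ext_scale d E)).
pose x : ghom P (ext_scale c E) := gpb1 _ _.
pose y : ghom P (ext_scale d E) := gpb2 _ _.
pose ex : ghom P E := ghom_compose (ext_scale_pr1 c E) x.
pose ey : ghom P E := ghom_compose (ext_scale_pr1 d E) y.
pose n : ghom P N := ghom_compose (ext_scale_pr c E) x.
have h p : ex_pr E ((ex + ey) p) = ((c + d) *: ghom_id N) (n p).
  rewrite /= ghomD [X in X + _](gpbE (x p)) [X in _ + X](gpbE (y p)).
  by rewrite -[gpb2 _ _ (y p)](gpbE p) /= !scalerDl.
apply: (ext_dom (E := ext_scale (c + d) E) (f := gpb_lift h) (g := baer_pi _ _)).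
- by move=> p; rewrite [RHS]baer_prE.
- move=> m; have [u hu] := ex_surj (ext_scale c E) m.
  have [v hv] := ex_surj (ext_scale d E) m.
  have huv : ex_pr (ext_scale c E) u = ex_pr (ext_scale d E) v by rewrite hu hv.
  by exists (gpb_mk huv).
- move=> p m /ext_scale_inE[e n0].
  have n0' : ext_scale_pr d E (y p) = 0 by rewrite -n0; apply/esym/(gpbE p).
  have /ex_exact[m1 e1] : ex_pr (ext_scale c E) (x p) = 0 by [].
  have /ex_exact[m2 e2] : ex_pr (ext_scale d E) (y p) = 0 by [].
  apply/baer_inE; exists m1, m2; split=> //.
  apply: (@ex_inj E); rewrite ghomD -e -[LHS]/(ex p + ey p).
  have -> : ex p = ex_in E m1.
    by rewrite -[LHS]/(ext_scale_pr1 c E (x p)) e1.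
  have -> // : ey p = ex_in E m2.
  by rewrite -[LHS]/(ext_scale_pr1 d E (y p)) e2.
Qed.

End Extensions.

(* A k-vector space in an arbitrary universe. The carrier of Ext^1 is a
   type of classes of modules, so it lives in a universe above the one of
   lmodType and cannot be given that structure.                         *)

Record bigvect (k : fieldType) := BigVect {
  bv_sort :> Type;
  bv0 : bv_sort;
  bvD : bv_sort -> bv_sort -> bv_sort;
  bvZ : k -> bv_sort -> bv_sort;
  bvDA : forall x y z, bvD x (bvD y z) = bvD (bvD x y) z;
  bvDC : forall x y, bvD x y = bvD y x;
  bvD0 : forall x, bvD bv0 x = x;
  bvDN : forall x, bvD (bvZ (-1) x) x = bv0;
  bvZA : forall a b x, bvZ a (bvZ b x) = bvZ (a * b) x;
  bvZ1 : forall x, bvZ 1 x = x;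
  bvZDr : forall a x y, bvZ a (bvD x y) = bvD (bvZ a x) (bvZ a y);
  bvZDl : forall a b x, bvZ (a + b) x = bvD (bvZ a x) (bvZ b x) }.

Definition bv_linear (k : fieldType) (U : lmodType k) (W : bigvect k)
    (f : U -> W) : Prop :=
  forall (a : k) (x y : U), f (a *: x + y) = bvD (bvZ a (f x)) (f y).

Section Ext1.
Variables (k : fieldType) (A : galg k) (N M : gmod A).
Local Notation ext := (ext N M).

Record ext_class := ExtClass {
  ec_mem : ext -> Prop;
  ec_class : exists E, ec_mem = ext_eqv E }.

Lemma ext_cls_subproof (E : ext) : exists F, ext_eqv E = ext_eqv F.
Proof. by exists E. Qed.
Definition ext_cls E : ext_class := ExtClass (ext_cls_subproof E).

Lemma ext_clsP E F : ext_cls E = ext_cls F <-> ext_eqv E F.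
Proof.
split=> [[->]|h]; first exact: ext_eqv_refl.
rewrite /ext_cls; move: (ext_cls_subproof E) (ext_cls_subproof F).
have -> : ext_eqv E = ext_eqv F.
  apply/funext => G; apply/propext; split; apply: ext_eqv_trans => //.
  exact: ext_eqv_sym.
by move=> p q; congr ExtClass; exact: Prop_irrelevance.
Qed.

Lemma ext_cls_surj (C : ext_class) : exists E, ext_cls E = C.
Proof.
case: C => C hC; have [E CE] := hC; exists E; rewrite /ext_cls.
move: (ext_cls_subproof E) hC; rewrite CE => p q.
by congr ExtClass; exact: Prop_irrelevance.
Qed.

Definition ext_repr (C : ext_class) : ext := projT1 (cid (ext_cls_surj C)).
Lemma ext_reprK C : ext_cls (ext_repr C) = C.
Proof. by rewrite /ext_repr; case: cid. Qed.
Lemma ext_cls_repr E : ext_eqv (ext_repr (ext_cls E)) E.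
Proof. by apply/ext_clsP; rewrite ext_reprK. Qed.

Definition Ext1_0 := ext_cls (ext_split N M).
Definition Ext1_D C D := ext_cls (baer_sum (ext_repr C) (ext_repr D)).
Definition Ext1_Z c C := ext_cls (ext_scale c (ext_repr C)).

Lemma Ext1_DE E F : Ext1_D (ext_cls E) (ext_cls F) = ext_cls (baer_sum E F).
Proof. by apply/ext_clsP/baer_sum_cong; exact: ext_cls_repr. Qed.
Lemma Ext1_ZE c E : Ext1_Z c (ext_cls E) = ext_cls (ext_scale c E).
Proof. by apply/ext_clsP/ext_scale_cong; exact: ext_cls_repr. Qed.

Lemma Ext1_DA C D E : Ext1_D C (Ext1_D D E) = Ext1_D (Ext1_D C D) E.
Proof.
rewrite -[C]ext_reprK -[D]ext_reprK -[E]ext_reprK !Ext1_DE.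
by apply/ext_clsP; exact: baer_sumA.
Qed.
Lemma Ext1_DC C D : Ext1_D C D = Ext1_D D C.
Proof. by apply/ext_clsP; exact: baer_sumC. Qed.
Lemma Ext1_D0 C : Ext1_D Ext1_0 C = C.
Proof.
by rewrite -[C]ext_reprK Ext1_DE; apply/ext_clsP; exact: baer_sum0.
Qed.
Lemma Ext1_DN C : Ext1_D (Ext1_Z (-1) C) C = Ext1_0.
Proof.
by rewrite -[C]ext_reprK Ext1_ZE Ext1_DE; apply/ext_clsP; exact: baer_sumN.
Qed.
Lemma Ext1_ZA a b C : Ext1_Z a (Ext1_Z b C) = Ext1_Z (a * b) C.
Proof.
by rewrite -[C]ext_reprK !Ext1_ZE; apply/ext_clsP; exact: ext_scaleA.
Qed.
Lemma Ext1_Z1 C : Ext1_Z 1 C = C.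
Proof.
by rewrite -[C]ext_reprK !Ext1_ZE; apply/ext_clsP; exact: ext_scale1.
Qed.
Lemma Ext1_ZDr a C D : Ext1_Z a (Ext1_D C D) = Ext1_D (Ext1_Z a C) (Ext1_Z a D).
Proof.
have [E <-] := ext_cls_surj C; have [F <-] := ext_cls_surj D.
rewrite Ext1_DE !Ext1_ZE Ext1_DE.
by apply/ext_clsP; exact: ext_scaleDr.
Qed.
Lemma Ext1_ZDl a b C : Ext1_Z (a + b) C = Ext1_D (Ext1_Z a C) (Ext1_Z b C).
Proof.
rewrite -[C]ext_reprK !Ext1_ZE !Ext1_DE.
by apply/ext_clsP; exact: ext_scaleDl.
Qed.

Definition Ext1 : bigvect k := BigVect Ext1_DA Ext1_DC Ext1_D0 Ext1_DN
  Ext1_ZA Ext1_Z1 Ext1_ZDr Ext1_ZDl.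
End Ext1.

Section Weights.
Variables (n : nat) (wt : 'I_n -> nat).

Definition wdeg (m : 'X_{1..n}) : nat := (\sum_(i < n) wt i * m i)%N.

Lemma wdegD m m' : wdeg (m + m')%MM = (wdeg m + wdeg m')%N.
Proof.
by rewrite /wdeg -big_split; apply: eq_bigr => i _; rewrite mnmDE mulnDr.
Qed.

Section Whom.
Variable T : comNzRingType.
Implicit Types p q : {mpoly T[n]}.

Definition whom (j : nat) p : Prop := forall m, m \in msupp p -> wdeg m = j.

Lemma whomP j p : whom j p <-> forall m, wdeg m != j -> p@_m = 0.
Proof.
split=> h m; first by move=> hm; apply: memN_msupp_eq0; apply: contra hm => /h ->.
by rewrite mcoeff_msupp => hp; apply/eqP; apply: contraNT hp => /h ->.
Qed.

Definition wcomp (j : nat) p : {mpoly T[n]} :=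
  \sum_(m <- msupp p | wdeg m == j) p@_m *: 'X_[m].

Lemma wcompE j p m : (wcomp j p)@_m = if wdeg m == j then p@_m else 0.
Proof.
rewrite /wcomp raddf_sum /=.
have [hm|hm] := boolP (m \in msupp p); last first.
  rewrite (memN_msupp_eq0 hm) if_same big_seq_cond big1 // => m' /andP[hm' _].
  rewrite mcoeffZ mcoeffX; case: eqP hm' => [->|_ _]; first by rewrite (negPf hm).
  by rewrite mulr0.
rewrite big_mkcond (bigD1_seq m) ?msupp_uniq //= big1 ?addr0.
  by case: ifP => _ //; rewrite mcoeffZ mcoeffX eqxx mulr1.
move=> m' hm'; case: ifP => _ //.
by rewrite mcoeffZ mcoeffX (negPf hm') mulr0.
Qed.

Lemma whom_grading : is_grading whom.
Proof.
apply: (@grading_of_comp _ _ _ wcomp).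
- by move=> i m; rewrite msupp0.
- move=> i p q /whomP hp /whomP hq; apply/whomP => m hm.
  by rewrite mcoeffB hp ?hq ?subr0.
- by move=> i p; apply/whomP => m /negPf hm; rewrite wcompE hm.
- move=> i p q; apply/mpolyP => m; rewrite mcoeffD !wcompE mcoeffD.
  by case: ifP => _; rewrite ?addr0.
- move=> i p /whomP hp; apply/mpolyP => m; rewrite wcompE.
  by case: ifPn => // /hp ->.
- move=> i j p /whomP hp hij; apply/mpolyP => m; rewrite wcompE mcoeff0.
  by case: eqP => // hm; apply: hp; rewrite hm.
- move=> p; exists (undup (map wdeg (msupp p))).
  apply/mpolyP => m; rewrite raddf_sum /=.
  under eq_bigr do rewrite wcompE.
  have [hm|hm] := boolP (m \in msupp p); last first.
    by rewrite (memN_msupp_eq0 hm) big1 // => i _; rewrite if_same.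
  rewrite (bigD1_seq (wdeg m)) ?undup_uniq ?mem_undup ?map_f //= eqxx.
  by rewrite big1 ?addr0 // => i /negPf; rewrite eq_sym => ->.
Qed.

Lemma whomM i j p q : whom i p -> whom j q -> whom (i + j)%N (p * q).
Proof.
move=> hp hq m /msuppM_le /allpairsP[[m1 m2] [/hp h1 /hq h2 ->]].
by rewrite wdegD h1 h2.
Qed.

Lemma whomC (c : T) : whom 0 c%:MP.
Proof.
move=> m; rewrite msuppC; case: eqP => // _; rewrite inE => /eqP ->.
by rewrite /wdeg big1 // => i _; rewrite mnm0E muln0.
Qed.

Lemma whomCM j (c : T) p : whom j p -> whom j (c *: p).
Proof. by move=> hp; rewrite -mul_mpolyC -[j]add0n; apply: whomM => //; exact: whomC. Qed.
End Whom.

Variable k : fieldType.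
Lemma wpoly_1 : whom 0 (1 : {mpoly k[n]}).
Proof. exact: whomC. Qed.
Definition wpoly : galg k := GAlg (@whom_grading k) (@whomCM k) wpoly_1 (@whomM k).

End Weights.

Record gvect (k : fieldType) := GVect {
  gv_vect :> vectType k;
  gv_gr : int -> {vspace gv_vect};
  gv_grading : is_grading (fun i v => v \in gv_gr i) }.

Section Span.
Variables (I : eqType) (M : zmodType) (gr : I -> M -> Prop).
Hypothesis gr0 : forall i, gr i 0.
Hypothesis grD : forall i x y, gr i x -> gr i y -> gr i (x + y).

Lemma span_pairs (l : seq (I * M)) : (forall p, p \in l -> gr p.1 p.2) ->
  exists (s : seq I) (f : I -> M),
    (forall i, gr i (f i)) /\ \sum_(p <- l) p.2 = \sum_(i <- s) f i.
Proof.
move=> hl; exists (undup (map fst l)), (fun i => \sum_(p <- l | p.1 == i) p.2).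
split=> [i|].
  rewrite big_seq_cond; elim/big_rec: _ => [|p x /andP[/hl hp /eqP <-] hx] //.
  exact: grD.
rewrite (exchange_big_dep predT) //= big_seq [RHS]big_seq; apply: eq_bigr => p hp.
rewrite -big_filter (_ : [seq i <- _ | _] = [:: p.1]) ?big_seq1 //.
rewrite (eq_filter (a2 := pred1 p.1)); last by move=> i; rewrite /= eq_sym.
by rewrite filter_pred1_uniq ?undup_uniq // mem_undup map_f.
Qed.
End Span.

Section TensorPoly.
Variables (k : fieldType) (V : gvect k) (n : nat) (wt : 'I_n -> nat).

Section OverT.
Variable T : comAlgType k.

(* V (x) R_T, for R_T = T[x_1, ..., x_n]: a tensor is given by its
   coordinates in a fixed basis of V, which need not be homogeneous.    *)
Definition VR : Type := 'rV[{mpoly T[n]}]_(\dim {:V}).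
HB.instance Definition _ := GRing.Lmodule.on VR.

Definition tens (v : V) (r : {mpoly T[n]}) : VR :=
  \row_j ((coord (vbasis {:V}) j v)%:A *: r).

(* The degree d part of V (x) R_T is the sum of the V_i (x) (R_T)_j with
   i + j = d.                                                           *)
Definition VR_gr (d : int) (w : VR) : Prop :=
  exists s : seq (V * {mpoly T[n]}),
    (forall x, x \in s -> exists (i : int) (j : nat),
      [/\ x.1 \in gv_gr V i, whom wt j x.2 & i + j%:Z = d]) /\
    w = \sum_(x <- s) tens x.1 x.2.

Lemma tensDl v v' r : tens (v + v') r = tens v r + tens v' r.
Proof. by apply/rowP => j; rewrite !mxE raddfD /= !scalerDl. Qed.
Lemma tensDr v r r' : tens v (r + r') = tens v r + tens v r'.
Proof. by apply/rowP => j; rewrite !mxE scalerDr. Qed.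
Lemma tens0l r : tens 0 r = 0.
Proof. by apply/rowP => j; rewrite !mxE raddf0 !scale0r. Qed.
Lemma tens0r v : tens v 0 = 0.
Proof. by apply/rowP => j; rewrite !mxE scaler0. Qed.
Lemma tensZ v r r' : tens v (r' * r) = r' *: tens v r.
Proof. by apply/rowP => j; rewrite !mxE scalerAr. Qed.
Lemma tens_scale c v r : tens (c *: v) r = tens v ((c%:A : T) *: r).
Proof.
apply/rowP => j; rewrite !mxE linearZ /= scalerA; congr (_ *: _).
by rewrite mulr_algl scalerA mulrC.
Qed.
Lemma tens_sumr v (J : Type) (s : seq J) P (f : J -> {mpoly T[n]}) :
  tens v (\sum_(j <- s | P j) f j) = \sum_(j <- s | P j) tens v (f j).
Proof. by rewrite (big_morph (tens v) (tensDr v) (tens0r v)). Qed.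
Lemma tens_suml r (J : Type) (s : seq J) P (f : J -> V) :
  tens (\sum_(j <- s | P j) f j) r = \sum_(j <- s | P j) tens (f j) r.
Proof.
by rewrite (big_morph (tens^~ r) (fun v w => tensDl v w r) (tens0l r)).
Qed.

Lemma VR_basis (w : VR) :
  w = \sum_(j < \dim {:V}) tens (vbasis {:V})`_j (w 0 j).
Proof.
apply/rowP => i; rewrite summxE (bigD1 i) //= big1 => [|j hj]; rewrite mxE.
  by rewrite coord_free ?(basis_free (vbasisP _)) // eqxx !scale1r addr0.
by rewrite coord_free ?(basis_free (vbasisP _)) // (negPf hj) !scale0r.
Qed.

Lemma VR_gr_0 d : VR_gr d 0.
Proof. by exists [::]; rewrite big_nil. Qed.
Lemma VR_gr_D d w w' : VR_gr d w -> VR_gr d w' -> VR_gr d (w + w').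
Proof.
move=> [s [hs ->]] [t [ht ->]]; exists (s ++ t); rewrite big_cat; split=> // x.
by rewrite mem_cat => /orP[/hs|/ht].
Qed.
Lemma VR_gr_tens i j v r : v \in gv_gr V i -> whom wt j r ->
  VR_gr (i + j%:Z) (tens v r).
Proof.
move=> hv hr; exists [:: (v, r)]; rewrite big_seq1; split=> // x.
by rewrite inE => /eqP ->; exists i, j.
Qed.
Lemma VR_gr_ind d (P : VR -> Prop) : P 0 ->
  (forall w w', P w -> P w' -> P (w + w')) ->
  (forall i j v r, v \in gv_gr V i -> whom wt j r -> i + j%:Z = d ->
    P (tens v r)) ->
  forall w, VR_gr d w -> P w.
Proof.
move=> P0 PD Pt _ [s [hs ->]]; rewrite big_seq; elim/big_rec: _ => // x w hx.
by have [i [j [h1 h2 h3]]] := hs _ hx; apply: PD; apply: (Pt i j).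
Qed.
Lemma VR_gr_act i j r w : whom wt i r -> VR_gr j w ->
  VR_gr (i%:Z + j) (r *: w).
Proof.
move=> hr; elim/VR_gr_ind=> [|x y|a b v s hv hs <-].
- by rewrite scaler0; exact: VR_gr_0.
- by rewrite scalerDr; exact: VR_gr_D.
- by rewrite -tensZ addrCA -PoszD; apply: VR_gr_tens => //; exact: whomM.
Qed.
Lemma VR_gr_N d w : VR_gr d w -> VR_gr d (- w).
Proof.
move=> hw; rewrite -scaleN1r -[d]add0r; apply: (@VR_gr_act 0%N) => //.
by rewrite -mpolyC1 -mpolyCN; exact: whomC.
Qed.

Let cV := comp (gv_grading V).
Let cR := comp (whom_grading wt T).
Let cZ (z : int) (r : {mpoly T[n]}) : {mpoly T[n]} :=
  if z is Posz j then cR j r else 0.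

Let cVZ c i v : cV i (c *: v) = c *: cV i v.
Proof.
apply: (comp_hom (gv_grading V) (gv_grading V) (f := *:%R c)).
  exact: scalerDr.
by move=> l x /= hx; exact: memvZ.
Qed.
Let cRZ (t : T) j r : cR j (t *: r) = t *: cR j r.
Proof.
apply: (comp_hom (whom_grading wt T) (whom_grading wt T) (f := *:%R t)).
  exact: scalerDr.
by move=> l x; exact: whomCM.
Qed.
Let cV0 i : cV i 0 = 0. Proof. exact: comp0. Qed.
Let cVD i v w : cV i (v + w) = cV i v + cV i w. Proof. exact: compD. Qed.
Let cZD z r r' : cZ z (r + r') = cZ z r + cZ z r'.
Proof. by case: z => j /=; rewrite ?addr0 // [LHS]compD. Qed.
Let cZZ (t : T) z r : cZ z (t *: r) = t *: cZ z r.
Proof. by case: z => j /=; rewrite ?scaler0 // [LHS]cRZ. Qed.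

Let VR_supp : exists sV : seq int, uniq sV /\
  forall i, i \notin sV -> forall v, cV i v = 0.
Proof.
have /choice[S hS] : forall j : 'I_(\dim {:V}), exists s : seq int,
    forall i, i \notin s -> cV i (vbasis {:V})`_j = 0.
  by move=> j; have [s [_ h _]] := comp_sum (gv_grading V) (vbasis {:V})`_j; exists s.
exists (undup (flatten [seq S j | j <- enum 'I_(\dim {:V})])).
split=> [|i]; first exact: undup_uniq.
rewrite mem_undup => hi v.
rewrite [v](coord_vbasis (memvf v)) (big_morph (cV i) (cVD i) (cV0 i)).
rewrite big1 // => j _; rewrite cVZ hS ?scaler0 //.
apply: contra hi => hi; apply/flattenP; exists (S j) => //.
by apply: map_f; rewrite mem_enum.
Qed.

Lemma VR_grading : is_grading VR_gr.
Proof.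
have [sV [uV hV]] := VR_supp.
pose c d (w : VR) : VR := \sum_(j < \dim {:V}) \sum_(i <- sV)
  tens (cV i (vbasis {:V})`_j) (cZ (d - i) (w 0 j)).
have cD d w w' : c d (w + w') = c d w + c d w'.
  rewrite -big_split; apply: eq_bigr => j _; rewrite -big_split.
  by apply: eq_bigr => i _; rewrite mxE cZD tensDr.
have c0 d : c d 0 = 0 by apply: (addIr (c d 0)); rewrite -cD !add0r.
have ct d v r : c d (tens v r) = \sum_(i <- sV) tens (cV i v) (cZ (d - i) r).
  rewrite /c exchange_big; apply: eq_bigr => i _.
  rewrite [v in RHS](coord_vbasis (memvf v)) (big_morph (cV i) (cVD i) (cV0 i)).
  rewrite tens_suml; apply: eq_bigr => j _.
  by rewrite mxE cZZ cVZ tens_scale.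
have cth d i j v r : v \in gv_gr V i -> whom wt j r ->
    c d (tens v r) = if d == i + j%:Z then tens v r else 0.
  move=> hv hr; rewrite ct.
  have -> : \sum_(l <- sV) tens (cV l v) (cZ (d - l) r) = tens v (cZ (d - i) r).
    have [hi|hi] := boolP (i \in sV).
      rewrite (bigD1_seq i) //= big1 => [|l hl].
        by rewrite addr0 [cV i v](comp_id (gv_grading V)).
      by rewrite [cV l v](comp_neq (gv_grading V) hv) ?tens0l.
    have v0 : v = 0 by rewrite -[v](comp_id (gv_grading V) hv); exact: hV.
    by rewrite v0 big1 ?tens0l // => l _; rewrite cV0 tens0l.
  case: eqP => [->|hd].
    by rewrite addrC addKr /= [cR j r](comp_id (whom_grading wt T)).
  case e: (d - i) => [l|l] /=; last by rewrite tens0r.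
  rewrite [cR l r](comp_neq (whom_grading wt T) hr) ?tens0r //.
  by apply/eqP => lj; apply: hd; rewrite -lj -e addrC subrK.
have cid' d w : VR_gr d w -> c d w = w.
  elim/VR_gr_ind=> [//|x y hx hy|i j v r hv hr <-]; first by rewrite cD hx hy.
  by rewrite (cth _ i j) // eqxx.
have cne d e w : VR_gr e w -> d != e -> c d w = 0.
  move=> hw de; move: w hw; apply: VR_gr_ind => [//|x y hx hy|i j v r hv hr h].
    by rewrite cD hx hy addr0.
  by rewrite (cth _ i j) // h (negPf de).
split.
- exact: VR_gr_0.
- by move=> d x y hx /VR_gr_N; exact: VR_gr_D.
- move=> w.
  suff [l [hl ->]] : exists l : seq (int * VR),
      (forall p, p \in l -> VR_gr p.1 p.2) /\ w = \sum_(p <- l) p.2.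
    exact: span_pairs VR_gr_0 VR_gr_D _ hl.
  pose Q (w : VR) := exists l : seq (int * VR),
      (forall p, p \in l -> VR_gr p.1 p.2) /\ w = \sum_(p <- l) p.2.
  have Q0 : Q 0 by exists [::]; rewrite big_nil.
  have QD x y : Q x -> Q y -> Q (x + y).
    move=> [s [hs ->]] [t [ht ->]]; exists (s ++ t); rewrite big_cat; split=> // p.
    by rewrite mem_cat => /orP[/hs|/ht].
  have Qt i j v r : v \in gv_gr V i -> whom wt j r -> Q (tens v r).
    move=> hv hr; exists [:: (i + j%:Z, tens v r)]; rewrite big_seq1.
    by split=> // p; rewrite inE => /eqP -> /=; exact: VR_gr_tens.
  rewrite -/(Q w) [w]VR_basis; elim/big_rec: _ => // j x _ hx; apply: (QD _ _ _ hx).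
  have [s [_ _ vE]] := comp_sum (gv_grading V) (vbasis {:V})`_j.
  have [t [_ _ rE]] := comp_sum (whom_grading wt T) (w 0 j).
  rewrite vE tens_suml; elim/big_rec: _ => // i y _ hy; apply: (QD _ _ _ hy).
  rewrite rE tens_sumr; elim/big_rec: _ => // l z _ hz; apply: (QD _ _ _ hz).
  apply: (Qt i l); first exact: (comp_gr (gv_grading V)).
  exact: (comp_gr (whom_grading wt T)).
- move=> s f us hf sf0 i si.
  have : c i (\sum_(j <- s) f j) = f i.
    rewrite (big_morph (c i) (cD i) (c0 i)) (bigD1_seq i) //= cid' //.
    by rewrite big1 ?addr0 // => j hj; apply: (cne _ j) => //; rewrite eq_sym.
  by rewrite sf0 c0 => <-.
Qed.
End OverT.

(* V (x) R as a graded module over R = k[x_1, ..., x_n].                *)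
Definition VR_gmod : gmod (wpoly wt k) :=
  @GMod k (wpoly wt k) ('rV[{mpoly k[n]}]_(\dim {:V})) (@VR_gr k^o)
    (VR_grading k^o) (@VR_gr_act k^o).

Definition VR_map (S T : comAlgType k) (phi : {rmorphism S -> T}) (w : VR S) :
  VR T := map_mx (map_mpoly phi) w.
End TensorPoly.

Section Finiteness.
Variables (k : fieldType) (A : algType k).

Definition central (z : A) : Prop := forall a, z * a = a * z.

(* P is meant to be the membership predicate of a subring of A.         *)
Definition module_finite (P : A -> Prop) : Prop :=
  exists s : seq A, forall a, exists c : 'I_(size s) -> A,
    (forall i, P (c i)) /\ a = \sum_i c i * s`_i.

Definition fg_center : Prop :=
  exists (m : nat) (z : 'I_m -> A), (forall i, central (z i)) /\
    forall a, central a -> exists q : {mpoly k[m]}, a = mmap (in_alg A) z q.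

Definition finite_dim (P : A -> Prop) : Prop :=
  exists s : seq A, (forall a, a \in s -> P a) /\
    forall a, P a -> exists c : 'I_(size s) -> k, a = \sum_i c i *: s`_i.
End Finiteness.

Definition fg_algebra (k : fieldType) (S : comAlgType k) : Prop :=
  exists (m : nat) (z : 'I_m -> S),
    forall a, exists q : {mpoly k[m]}, a = mmap (in_alg S) z q.

(* A central polynomial subring k[x_1, ..., x_n] on homogeneous elements
   x_i of degree gp_wt i.                                               *)
Record gpolysub (k : fieldType) (A : galg k) := GPolySub {
  gp_n : nat;
  gp_wt : 'I_gp_n -> nat;
  gp_incl : {lrmorphism {mpoly k[gp_n]} -> A};
  gp_inj : injective gp_incl;
  gp_central : forall r, central (gp_incl r);
  gp_homog : forall i, ga_gr (gp_wt i) (gp_incl 'X_i) }.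
Arguments gp_wt {k A} g _.

Definition gp_mem (k : fieldType) (A : galg k) (R : gpolysub A) (a : A) : Prop :=
  exists r, a = gp_incl R r.

Section Rep.
Variables (k : fieldType) (A : galg k) (R : gpolysub A) (V : gvect k).
Local Notation VT T := (VR V (gp_n R) T).

(* A T (x) A-module is a T-module with a T-linear action of A, since the
   T- and A-actions commute. So a graded A_T-module structure on V (x) R_T
   extending the R_T-module structure is a graded T-linear A-action for
   which r in R acts by scalar multiplication by r.                      *)
Record Rep (T : comAlgType k) := MkRep {
  rep_act :> A -> VT T -> VT T;
  rep_linT : forall a (t : T) w w',
    rep_act a (t%:MP *: w + w') = t%:MP *: rep_act a w + rep_act a w';
  rep_linA : forall (c : k) a b w,
    rep_act (c *: a + b) w = (c%:A : T)%:MP *: rep_act a w + rep_act b w;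
  rep_1 : forall w, rep_act 1 w = w;
  rep_M : forall a b w, rep_act (a * b) w = rep_act a (rep_act b w);
  rep_R : forall r w,
    rep_act (gp_incl R r) w = map_mpoly (in_alg T) r *: w;
  rep_gr : forall (i : nat) (j : int) a w, ga_gr i a ->
    VR_gr (gp_wt R) j w -> VR_gr (gp_wt R) (i%:Z + j) (rep_act a w) }.

(* q = Rep(phi)(p): the A_T-structure q on V (x) R_T is the extension of
   scalars of p along phi : S -> T. It is determined by p, as the image of
   V (x) R_S spans V (x) R_T over T.                                     *)
Definition base_change (S T : comAlgType k) (phi : {lrmorphism S -> T})
    (p : Rep S) (q : Rep T) : Prop :=
  forall a w, q a (VR_map phi w) = VR_map phi (p a w).

(* Spec O represents the functor Rep, with universal point u.            *)
Definition represents (O : comAlgType k) (u : Rep O) : Prop :=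
  forall (T : comAlgType k) (q : Rep T),
    exists2 phi : {lrmorphism O -> T}, base_change phi u q &
      forall psi : {lrmorphism O -> T}, base_change psi u q -> psi =1 phi.

Section Module.
Variable p : Rep k^o.

Definition Mp_type : Type := VT k^o.
HB.instance Definition _ := GRing.Zmodule.on Mp_type.

Lemma rep_D a w w' : p a (w + w') = p a w + p a w'.
Proof. by rewrite -[w in LHS]scale1r -mpolyC1 rep_linT !mpolyC1 !scale1r. Qed.
Lemma rep_DA a b w : p (a + b) w = p a w + p b w.
Proof. by rewrite -[a in LHS]scale1r rep_linA !scale1r. Qed.

HB.instance Definition _ := GRing.Zmodule_isLmodule.Build A Mp_type
  (fun a b w => esym (rep_M p a b w)) (rep_1 p) rep_D
  (fun w a b => rep_DA a b w).

Definition Mp : gmod A :=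
  @GMod k A Mp_type (VR_gr (gp_wt R) (T := k^o)) (VR_grading V (gp_wt R) k^o)
    (fun i j a w => @rep_gr _ p i j a w).
End Module.
End Rep.

Section Tangent.
Variables (k : fieldType) (O : comAlgType k) (x : {lrmorphism O -> k^o}).

Definition maxid_pred : {pred O} := fun y => x y == 0.
Lemma maxid_submod : submod_closed maxid_pred.
Proof.
split=> [|a y z]; rewrite !unfold_in ?raddf0 // => /eqP hy /eqP hz.
by rewrite linearP [X in _ *: X]hy [X in _ + X]hz scaler0 addr0.
Qed.
HB.instance Definition _ :=
  GRing.isSubmodClosed.Build k O maxid_pred maxid_submod.

Record maxid := MaxId { maxid_val : O; _ : maxid_val \in maxid_pred }.
HB.instance Definition _ := [isSub for maxid_val].
HB.instance Definition _ := [Choice of maxid by <:].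
HB.instance Definition _ := [SubChoice_isSubLmodule of maxid by <:].

(* The tangent space at x is (m / m^2)^*, for m the kernel of x: the
   linear forms on m that vanish on products of two elements of m.       *)
Definition is_tangent (t : maxid -> k^o) : Prop := linear t /\
  forall a b c : maxid, maxid_val c = maxid_val a * maxid_val b -> t c = 0.
Definition tangent_pred : {pred (maxid -> k^o)} := fun t => `[< is_tangent t >].
Lemma tangent_submod : submod_closed tangent_pred.
Proof.
split=> [|a s t]; rewrite !unfold_in.
  by apply/asboolP; split=> [c y z|//]; rewrite scaler0 addr0.
move=> /asboolP[s1 s2] /asboolP[t1 t2]; apply/asboolP; split=> [c y z|b c d e].
  rewrite -[LHS]/(a *: s (c *: y + z) + t (c *: y + z)) s1 t1.
  rewrite -[RHS]/(c *: (a *: s y + t y) + (a *: s z + t z)).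
  by rewrite !scalerDr !scalerA [c * a]mulrC addrACA.
by rewrite -[LHS]/(a *: s d + t d) (s2 _ _ _ e) (t2 _ _ _ e) scaler0 addr0.
Qed.
HB.instance Definition _ :=
  GRing.isSubmodClosed.Build k (maxid -> k^o) tangent_pred tangent_submod.

Record tangent := Tangent {
  tangent_val :> maxid -> k^o; _ : tangent_val \in tangent_pred }.
HB.instance Definition _ := [isSub for tangent_val].
HB.instance Definition _ := [Choice of tangent by <:].
HB.instance Definition _ := [SubChoice_isSubLmodule of tangent by <:].
End Tangent.

Definition exact5 (k : fieldType) (U1 U2 U3 : lmodType k) (U4 : bigvect k)
    (f : {linear U1 -> U2}) (g : {linear U2 -> U3}) (h : U3 -> U4) : Prop :=
  [/\ injective f,
      forall u, g u = 0 <-> exists v, u = f v,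
      forall u, h u = bv0 U4 <-> exists v, u = g v
    & forall w, exists u, h u = w].

(* Main.v *)
Require Import Defs.
From HB Require Import structures.
From mathcomp Require Import all_boot all_order all_algebra.
From mathcomp Require Import mpoly.
From mathcomp Require Import boolp.

(** The idea is that all terms of the sequence can be read in terms of one kind
    of object: maps D that assign to a in A an endomorphism of V (x) R, killing
    R, preserving degrees, and satisfying D (a b) = a (D b) + (D a) b, where a
    and b act through p.

    On the one hand these are the tangent vectors at p. A tangent vector is a
    derivation d of the coordinate ring O at the point x, and D is the
    derivative of the universal action along d ([der_action_deformation]).
    Conversely p + eps D is a structure over the dual numbers, hence a
    k[eps]-valued point of the representing scheme, unique by representability;
    its eps-component is d ([der_action_inj], [der_action_surj]).

    On the other hand D is a cocycle which twists the A-action on M_p (+) M_p to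
    an extension of M_p by itself ([cocycle_ext]). Every extension arises in
    this way, because M_p is free over R, so that the extension splits as a
    sequence of graded R-modules ([Mp_R_section]), and the failure of the
    splitting to be A-linear is a cocycle that kills R ([section_cocycle]).
    Baer sums and multiples of extensions correspond to sums and multiples of
    cocycles ([cocycle_ext_lin]). The extension splits over A exactly when D is
    the commutator with a degree-preserving R-linear map phi
    ([cocycle_ext_split]).

    So the cokernel of phi |-> [A, phi] is Ext^1, and the kernel of this map
    consists of the phi that commute with A, which are the endomorphisms of
    M_p. *)

Set Implicit Arguments.
Unset Strict Implicit.
Unset Printing Implicit Defensive.
Import GRing.Theory.
Local Open Scope ring_scope.

(** * Maps of V (x) R_S to V (x) R_T applied to all coefficients *)

Section CoefficientwiseMaps.
Variables (k : fieldType) (V : gvect k) (n : nat).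
Local Notation VT := (VR V n).

Lemma VR_coefP (T : comAlgType k) (w w' : VT T) :
  (forall j m, (w 0 j)@_m = (w' 0 j)@_m) -> w = w'.
Proof. by move=> h; apply/rowP => j; apply/mpolyP => m. Qed.

(** The map is locked because unification would otherwise unfold the entrywise
    polynomial arithmetic on both sides of every failed match; for the same
    reason the proofs below say in which subterm they rewrite. *)
Fact coef_map_key : unit. Proof. exact: tt. Qed.
Definition coef_map (S T : comAlgType k) (f : S -> T) (w : VT S) : VT T :=
  locked_with coef_map_key (map_mx (map_mpoly f) w).

Lemma VR_mapE (S T : comAlgType k) (f : {rmorphism S -> T}) (w : VT S) :
  VR_map f w = coef_map f w.
Proof. by rewrite /coef_map locked_withE. Qed.

Lemma VR_coefD (T : comAlgType k) (w w' : VT T) j m :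
  ((w + w') 0 j)@_m = (w 0 j)@_m + (w' 0 j)@_m.
Proof. by rewrite mxE mcoeffD. Qed.

Lemma VR_coefC (T : comAlgType k) (c : T) (w : VT T) j m :
  ((c%:MP *: w) 0 j)@_m = c * (w 0 j)@_m.
Proof. by rewrite mxE mcoeffCM. Qed.

Lemma map_mpoly_in_alg_k (r : {mpoly k[n]}) :
  map_mpoly (in_alg (k^o)) r = r.
Proof.
apply/mpolyP => m; rewrite mcoeff_map_mpoly; exact: mulr1.
Qed.

Section Additive.
Variables (S T : comAlgType k) (f : {additive S -> T}).

Lemma coef_mapE w j m : (coef_map f w 0 j)@_m = f (w 0 j)@_m.
Proof. by rewrite /coef_map locked_withE mxE mcoeff_map_mpoly. Qed.

Lemma coef_mapD w w' : coef_map f (w + w') = coef_map f w + coef_map f w'.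
Proof.
by apply: VR_coefP => j m; rewrite coef_mapE !VR_coefD raddfD !coef_mapE.
Qed.

Lemma coef_map0 : coef_map f 0 = 0.
Proof. by apply: VR_coefP => j m; rewrite coef_mapE !mxE !mcoeff0 raddf0. Qed.
End Additive.

Lemma coef_map_comp (S T U : comAlgType k) (f : {additive S -> T})
    (g : {additive T -> U}) (h : {additive S -> U}) w :
  (forall s, g (f s) = h s) -> coef_map g (coef_map f w) = coef_map h w.
Proof. by move=> e; apply: VR_coefP => j m; rewrite !coef_mapE e. Qed.

Lemma coef_map_id (T : comAlgType k) (f : {additive T -> T}) w :
  (forall s, f s = s) -> coef_map f w = w.
Proof. by move=> e; apply: VR_coefP => j m; rewrite coef_mapE e. Qed.

Lemma coef_map_eq0 (S T : comAlgType k) (f : {additive S -> T}) w :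
  (forall s, f s = 0) -> coef_map f w = 0.
Proof.
by move=> e; apply: VR_coefP => j m; rewrite coef_mapE e mxE mcoeff0.
Qed.

Lemma coef_map_scale (S T : comAlgType k) (f g : {additive S -> T}) s t w :
  (forall u, f (s * u) = t * g u) ->
  coef_map f (s%:MP *: w) = t%:MP *: coef_map g w.
Proof.
by move=> e; apply: VR_coefP => j m; rewrite coef_mapE !VR_coefC coef_mapE e.
Qed.

(** The hypothesis is the form that the product rule takes both for the
    eps-component on the dual numbers and for a derivation at a point. *)
Lemma coef_map_leibniz (S T : comAlgType k) (f g h : {additive S -> T})
    s t t' w :
  (forall u, f (s * u) = t * g u + t' * h u) ->
  coef_map f (s%:MP *: w) = t%:MP *: coef_map g w + t'%:MP *: coef_map h w.
Proof.
move=> e; apply: VR_coefP => j m.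
rewrite [LHS]coef_mapE [RHS]VR_coefD (VR_coefC s w j m) e.
by congr (_ + _); rewrite [RHS]VR_coefC; congr (_ * _); rewrite [RHS]coef_mapE.
Qed.

Section Linear.
Variables (S T : comAlgType k) (f : {linear S -> T}).

Lemma coef_map_mulk (r : {mpoly k[n]}) w :
  coef_map f (map_mpoly (in_alg S) r *: w) =
  map_mpoly (in_alg T) r *: coef_map f w.
Proof.
apply: VR_coefP => j m; rewrite coef_mapE !mxE !mcoeffM raddf_sum /=.
apply: eq_bigr => i _; rewrite !mcoeff_map_mpoly coef_mapE /=.
by rewrite !mulr_algl; exact: linearZ_LR.
Qed.

Lemma coef_map_tens v r : coef_map f (tens v r) = tens v (map_mpoly f r).
Proof.
apply: VR_coefP => j m; rewrite coef_mapE !mxE !mcoeffZ mcoeff_map_mpoly.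
by rewrite !mulr_algl; exact: linearZ_LR.
Qed.

Lemma coef_map_gr (wt : 'I_n -> nat) d w :
  VR_gr wt d w -> VR_gr wt d (coef_map f w).
Proof.
elim/VR_gr_ind => [|x y|i j v r hv /whomP hr <-].
- by rewrite coef_map0; exact: VR_gr_0.
- by rewrite coef_mapD; exact: VR_gr_D.
- rewrite coef_map_tens; apply: VR_gr_tens => //; apply/whomP => m hm.
  by rewrite mcoeff_map_mpoly hr ?raddf0.
Qed.
End Linear.

Section Constants.
Variable T : comAlgType k.

Definition unitk (c : k^o) : T := c%:A.
Lemma unitk_linear : linear unitk.
Proof. by move=> c a b; rewrite /unitk scalerDl scalerA. Qed.
HB.instance Definition _ :=
  GRing.isLinear.Build k k^o T *:%R unitk unitk_linear.

Fact const_vec_key : unit. Proof. exact: tt. Qed.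
Definition const_vec (w : VT k^o) : VT T :=
  locked_with const_vec_key (coef_map unitk w).
Lemma const_vecE w : const_vec w = coef_map unitk w.
Proof. exact: locked_withE. Qed.
End Constants.

(** V (x) R_T is spanned over T by the image of V (x) R, so additive
    identities need only be checked on multiples of constant vectors. *)
Lemma VR_scalar_ext_ind (T : comAlgType k) (P : VT T -> Prop) : P 0 ->
  (forall w w', P w -> P w' -> P (w + w')) ->
  (forall c (w : VT k^o), P (c%:MP *: const_vec T w)) ->
  forall w, P w.
Proof.
move=> P0 PD Pc w; rewrite [w]row_sum_delta; elim/big_rec: _ => // j x _ hx.
apply: (PD _ _ _ _) => //; rewrite (mpolyE (w 0 j)) scaler_suml.
elim/big_rec: _ => // m y _ hy.
apply: (PD _ _ _ _) => //.
set c := mcoeff m _.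
have -> : (c *: 'X_[T, m]) *: delta_mx 0 j =
    c%:MP *: const_vec T (('X_[k, m] : {mpoly k^o[n]}) *: delta_mx 0 j).
  rewrite -mul_mpolyC -scalerA; congr (_ *: _).
  apply: VR_coefP => i m'; rewrite const_vecE coef_mapE !mxE eqxx /=.
  case: (i == j); rewrite ?mulr1 ?mulr0 ?mcoeff0 ?raddf0 // !mcoeffX.
  by case: (m == m'); rewrite /unitk ?scale1r ?scale0r.
exact: Pc.
Qed.
End CoefficientwiseMaps.

(** * The dual numbers and vectors over them *)

Section DualNumbers.
Variable k : fieldType.

(** The algebra k[eps]/(eps^2), as a record rather than a pair, so that the
    componentwise product of pairs cannot be inferred for it. *)
Record dual := Dual { std_part : k^o; eps_part : k^o }.
Implicit Types u v w : dual.

Lemma dualP u v : std_part u = std_part v -> eps_part u = eps_part v -> u = v.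
Proof. by case: u v => a b [c d] /= -> ->. Qed.

Definition dual_to_pair u := (std_part u, eps_part u).
Definition dual_of_pair (p : k^o * k^o) := Dual p.1 p.2.
Lemma dual_to_pairK : cancel dual_to_pair dual_of_pair.
Proof. by case. Qed.
HB.instance Definition _ := Choice.copy dual (can_type dual_to_pairK).

Definition dual_add u v :=
  Dual (std_part u + std_part v) (eps_part u + eps_part v).
Definition dual_opp u := Dual (- std_part u) (- eps_part u).
Lemma dual_addA : associative dual_add.
Proof. by move=> u v w; apply: dualP; rewrite /= addrA. Qed.
Lemma dual_addC : commutative dual_add.
Proof. by move=> u v; apply: dualP; rewrite /= addrC. Qed.
Lemma dual_add0 : left_id (Dual 0 0) dual_add.
Proof. by move=> u; apply: dualP; rewrite /= add0r. Qed.
Lemma dual_addN : left_inverse (Dual 0 0) dual_opp dual_add.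
Proof. by move=> u; apply: dualP; rewrite /= addNr. Qed.
HB.instance Definition _ := GRing.isZmodule.Build dual
  dual_addA dual_addC dual_add0 dual_addN.

Definition dual_scale (c : k) u := Dual (c *: std_part u) (c *: eps_part u).
Lemma dual_scaleA c d u : dual_scale c (dual_scale d u) = dual_scale (c * d) u.
Proof. by apply: dualP; rewrite /= scalerA. Qed.
Lemma dual_scale1 : left_id 1 dual_scale.
Proof. by move=> u; apply: dualP; rewrite /= scale1r. Qed.
Lemma dual_scaleDr : right_distributive dual_scale +%R.
Proof. by move=> c u v; apply: dualP; rewrite /= scalerDr. Qed.
Lemma dual_scaleDl u : {morph dual_scale^~ u : c d / c + d}.
Proof. by move=> c d; apply: dualP; rewrite /= scalerDl. Qed.
HB.instance Definition _ := GRing.Zmodule_isLmodule.Build k dual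
  dual_scaleA dual_scale1 dual_scaleDr dual_scaleDl.

Definition dual_mul u v :=
  Dual (std_part u * std_part v)
       (std_part u * eps_part v + eps_part u * std_part v).
Lemma dual_mulA : associative dual_mul.
Proof.
move=> u v w; apply: dualP; rewrite /= ?mulrA //.
by rewrite mulrDr mulrDl !mulrA addrA.
Qed.
Lemma dual_mulC : commutative dual_mul.
Proof.
move=> u v; apply: dualP; first exact: mulrC.
by rewrite /= addrC [eps_part u * _]mulrC [std_part u * _]mulrC.
Qed.
Lemma dual_mul1 : left_id (Dual 1 0) dual_mul.
Proof. by move=> u; apply: dualP; rewrite /= !mul1r // mul0r addr0. Qed.
Lemma dual_mulDl : left_distributive dual_mul +%R.
Proof.
move=> u v w; apply: dualP; rewrite /= !mulrDl //.
by rewrite addrACA.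
Qed.
Lemma dual_1_neq0 : Dual 1 0 != 0.
Proof. by apply/eqP => -[] /eqP; rewrite oner_eq0. Qed.
HB.instance Definition _ := GRing.Zmodule_isComNzRing.Build dual
  dual_mulA dual_mulC dual_mul1 dual_mulDl dual_1_neq0.

Lemma dual_scaleAl (c : k) u v : c *: (u * v) = (c *: u) * v.
Proof. by apply: dualP; rewrite /= ?scalerDr !scalerAl. Qed.
HB.instance Definition _ := GRing.Lmodule_isLalgebra.Build k dual dual_scaleAl.
HB.instance Definition _ := GRing.Lalgebra_isComAlgebra.Build k dual.

Lemma std_part_linear : linear std_part. Proof. by []. Qed.
HB.instance Definition _ :=
  GRing.isLinear.Build k dual k^o *:%R std_part std_part_linear.
Lemma std_part_monoid : monoid_morphism std_part. Proof. by []. Qed.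
HB.instance Definition _ :=
  GRing.isMonoidMorphism.Build dual k^o std_part std_part_monoid.
Lemma eps_part_linear : linear eps_part. Proof. by []. Qed.
HB.instance Definition _ :=
  GRing.isLinear.Build k dual k^o *:%R eps_part eps_part_linear.

Definition eps_embed (c : k^o) : dual := Dual 0 c.
Lemma eps_embed_linear : linear eps_embed.
Proof. by move=> a b c; apply: dualP; rewrite //= scaler0 add0r. Qed.
HB.instance Definition _ :=
  GRing.isLinear.Build k k^o dual *:%R eps_embed eps_embed_linear.

Lemma std_part_unitk (c : k^o) : std_part (unitk dual c) = c.
Proof. exact: mulr1. Qed.
Lemma eps_part_unitk (c : k^o) : eps_part (unitk dual c) = 0.
Proof. exact: mulr0. Qed.

Section Vectors.
Variables (V : gvect k) (n : nat).
Local Notation VT := (VR V n).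

Definition vec_std : VT dual -> VT k^o := @coef_map _ _ _ dual k^o std_part.
Definition vec_eps : VT dual -> VT k^o := @coef_map _ _ _ dual k^o eps_part.
Fact vec_pair_key : unit. Proof. exact: tt. Qed.
Definition vec_pair (u v : VT k^o) : VT dual := locked_with vec_pair_key
  (const_vec dual u + @coef_map _ _ _ k^o dual eps_embed v).

Lemma vec_pairE (u v : VT k^o) :
  vec_pair u v = const_vec dual u + @coef_map _ _ _ k^o dual eps_embed v.
Proof. exact: locked_withE. Qed.
Lemma vec_stdD (w w' : VT dual) : vec_std (w + w') = vec_std w + vec_std w'.
Proof. exact: coef_mapD. Qed.
Lemma vec_epsD (w w' : VT dual) : vec_eps (w + w') = vec_eps w + vec_eps w'.
Proof. exact: coef_mapD. Qed.
Lemma vec_std_const (u : VT k^o) : vec_std (const_vec dual u) = u.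
Proof.
rewrite const_vecE.
apply: etrans (coef_map_comp (h := idfun) _ std_part_unitk) _.
exact: (@coef_map_id _ _ _ k^o idfun).
Qed.
Lemma vec_eps_const (u : VT k^o) : vec_eps (const_vec dual u) = 0.
Proof.
rewrite const_vecE; apply: etrans (coef_map_comp (h := \0) _ eps_part_unitk) _.
exact: (@coef_map_eq0 _ _ _ k^o k^o \0).
Qed.
Lemma vec_std_pair (u v : VT k^o) : vec_std (vec_pair u v) = u.
Proof.
rewrite vec_pairE vec_stdD (vec_std_const u) -[RHS]addr0; congr (_ + _).
apply: etrans (coef_map_comp (h := \0) _ _) _ => //.
exact: (@coef_map_eq0 _ _ _ k^o k^o \0).
Qed.
Lemma vec_eps_pair (u v : VT k^o) : vec_eps (vec_pair u v) = v.
Proof.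
rewrite vec_pairE vec_epsD (vec_eps_const u) -[RHS]add0r; congr (_ + _).
apply: etrans (coef_map_comp (h := idfun) _ _) _ => //.
exact: (@coef_map_id _ _ _ k^o idfun).
Qed.
Lemma dual_vecP (w w' : VT dual) :
  vec_std w = vec_std w' -> vec_eps w = vec_eps w' -> w = w'.
Proof.
have vec_stdE (v : VT dual) j m : std_part (v 0 j)@_m = (vec_std v 0 j)@_m.
  exact/esym/coef_mapE.
have vec_epsE (v : VT dual) j m : eps_part (v 0 j)@_m = (vec_eps v 0 j)@_m.
  exact/esym/coef_mapE.
move=> h1 h2; apply: VR_coefP => j m.
by apply: dualP; rewrite ?vec_stdE ?vec_epsE ?h1 ?h2.
Qed.
Lemma vec_std_scale (t : dual) (w : VT dual) :
  vec_std (t%:MP *: w) = (std_part t)%:MP *: vec_std w.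
Proof. exact: coef_map_scale. Qed.
Lemma vec_eps_scale (t : dual) (w : VT dual) :
  vec_eps (t%:MP *: w) =
  (std_part t)%:MP *: vec_eps w + (eps_part t)%:MP *: vec_std w.
Proof. exact: coef_map_leibniz. Qed.
Lemma vec_std_lin (t : dual) (w w' : VT dual) :
  vec_std (t%:MP *: w + w') = (std_part t)%:MP *: vec_std w + vec_std w'.
Proof. by rewrite vec_stdD vec_std_scale. Qed.
Lemma vec_eps_lin (t : dual) (w w' : VT dual) : vec_eps (t%:MP *: w + w') =
  (std_part t)%:MP *: vec_eps w + (eps_part t)%:MP *: vec_std w + vec_eps w'.
Proof. by rewrite vec_epsD vec_eps_scale. Qed.
End Vectors.
End DualNumbers.

(** * First-order deformations of a module structure *)

Lemma addr_shuffle (M : nmodType) (x y z u v : M) :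
  x + y + (z + (u + v)) = x + z + u + (y + v).
Proof.
rewrite -!addrA; congr (_ + _); rewrite addrCA; congr (_ + _).
exact: addrCA.
Qed.

Section Representations.
Variables (k : fieldType) (A : galg k) (R : gpolysub A) (V : gvect k).
Local Notation VT := (VR V (gp_n R)).
Local Notation W := (VT k^o).

Section OverT.
Variables (T : comAlgType k) (q : Rep R V T).

Lemma rep_addr a w w' : q a (w + w') = q a w + q a w'.
Proof. by have := rep_linT q a 1 w w'; rewrite !mpolyC1 !scale1r. Qed.
Lemma rep_0r a : q a 0 = 0.
Proof. by apply: (addIr (q a 0)); rewrite -rep_addr !add0r. Qed.
Lemma rep_scaler a (t : T) w : q a (t%:MP *: w) = t%:MP *: q a w.
Proof. by have := rep_linT q a t w 0; rewrite rep_0r !addr0. Qed.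

Lemma rep_mulk a (r : {mpoly k[gp_n R]}) w :
  q a (map_mpoly (in_alg T) r *: w) = map_mpoly (in_alg T) r *: q a w.
Proof. by rewrite -!(rep_R q) -!rep_M gp_central. Qed.
End OverT.

Lemma rep_mulR (p : Rep R V k^o) a (r : {mpoly k[gp_n R]}) (w : W) :
  p a (r *: w) = r *: p a w.
Proof. by have := rep_mulk p a r w; rewrite map_mpoly_in_alg_k. Qed.

Section Derivations.
Variable p : Rep R V k^o.

(** A first-order variation a |-> p a + eps D a of the structure p, subject to
    the equations which make it a graded structure over the dual numbers that
    still extends the action of R; linearity of D a over R follows from these
    because R is central. *)
Record is_deformation (D : A -> W -> W) : Prop := IsDeformation {
  def_addr : forall a w w', D a (w + w') = D a w + D a w';
  def_linA : forall (c : k) a b w,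
    D (c *: a + b) w = (c%:MP : {mpoly k[gp_n R]}) *: D a w + D b w;
  def_M : forall a b w, D (a * b) w = p a (D b w) + D a (p b w);
  def_R : forall r w, D (gp_incl R r) w = 0;
  def_gr : forall (i : nat) (j : int) a w, ga_gr i a ->
    VR_gr (gp_wt R) j w -> VR_gr (gp_wt R) (i%:Z + j) (D a w) }.

Section Theory.
Variables (D : A -> W -> W) (hD : is_deformation D).

(** Since D kills R, the product rule turns D (a * r) and D (r * a) into
    D a (r *: w) and r *: D a w; these agree as r is central. *)
Lemma def_mulR a (r : {mpoly k[gp_n R]}) (w : W) : D a (r *: w) = r *: D a w.
Proof.
have pR (v : W) : p (gp_incl R r) v = r *: v.
  by rewrite rep_R map_mpoly_in_alg_k.
have := def_M hD a (gp_incl R r) w; rewrite (def_R hD) rep_0r add0r pR => <-.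
by rewrite -gp_central (def_M hD) (def_R hD) pR addr0.
Qed.

Lemma def_1 w : D 1 w = 0.
Proof. by rewrite -(rmorph1 (gp_incl R)) (def_R hD). Qed.

(** The action of p + eps D on w0 + eps w1: its eps-component collects the
    terms D a w0 and p a w1, and the remaining term eps^2 D a w1 vanishes. *)
Definition deform_act (a : A) (w : VT (dual k)) : VT (dual k) :=
  vec_pair (p a (vec_std w)) (D a (vec_std w) + p a (vec_eps w)).

Lemma vec_std_deform a w : vec_std (deform_act a w) = p a (vec_std w).
Proof. exact: vec_std_pair. Qed.
Lemma vec_eps_deform a w :
  vec_eps (deform_act a w) = D a (vec_std w) + p a (vec_eps w).
Proof. exact: vec_eps_pair. Qed.

Lemma deform_linT a (t : dual k) (w w' : VT (dual k)) :
  deform_act a (t%:MP *: w + w') = t%:MP *: deform_act a w + deform_act a w'.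
Proof.
apply: dual_vecP.
  rewrite [LHS]vec_std_deform [RHS]vec_std_lin.
  rewrite (vec_std_lin t w w') [LHS]rep_linT.
  by congr (_ *: _ + _); rewrite [RHS]vec_std_deform.
rewrite [LHS]vec_eps_deform [RHS]vec_eps_lin.
rewrite (vec_std_lin t w w') (vec_eps_lin t w w').
rewrite [X in X + _](def_addr hD) [X in X + _ + _]def_mulR.
rewrite -[X in p a X]addrA [X in _ + X]rep_linT [X in _ + (_ + X)]rep_linT.
rewrite [X in _ = X + _ + _](_ : _ = (std_part t)%:MP *: D a (vec_std w) +
  (std_part t)%:MP *: p a (vec_eps w)); last first.
  by rewrite -scalerDr [vec_eps _]vec_eps_deform.
rewrite [X in _ = _ + X]vec_eps_deform [X in _ = _ + _ *: X + _]vec_std_deform.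
exact: addr_shuffle.
Qed.

Lemma deform_linA (c : k) a b (w : VT (dual k)) : deform_act (c *: a + b) w =
  (c%:A : dual k)%:MP *: deform_act a w + deform_act b w.
Proof.
have e1 : std_part (c%:A : dual k) = c by exact: mulr1.
have e2 : eps_part (c%:A : dual k) = 0 by exact: mulr0.
have pc (v : W) : p (c *: a + b) v = c%:MP *: p a v + p b v.
  by rewrite rep_linA [in LHS](mulr1 c : c%:A = c :> k^o).
apply: dual_vecP.
  rewrite [LHS]vec_std_deform [RHS]vec_std_lin e1 [LHS]pc.
  by congr (_ *: _ + _); rewrite [RHS]vec_std_deform.
rewrite [LHS]vec_eps_deform [RHS]vec_eps_lin e1 e2 mpolyC0 scale0r addr0.
rewrite [X in _ = _ *: X + _]vec_eps_deform [X in _ = _ + X]vec_eps_deform.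
rewrite [X in _ + X = _]pc [X in X + _ = _](def_linA hD).
by rewrite scalerDr addrACA.
Qed.

Lemma deform_1 (w : VT (dual k)) : deform_act 1 w = w.
Proof.
apply: dual_vecP; first by rewrite [LHS]vec_std_deform; exact: rep_1.
by rewrite [LHS]vec_eps_deform [X in X + _]def_1 [LHS]add0r; exact: rep_1.
Qed.

Lemma deform_M a b (w : VT (dual k)) :
  deform_act (a * b) w = deform_act a (deform_act b w).
Proof.
apply: dual_vecP.
  rewrite [LHS]vec_std_deform [RHS]vec_std_deform.
  rewrite [X in _ = p a X]vec_std_deform.
  exact: rep_M.
rewrite [LHS]vec_eps_deform [RHS]vec_eps_deform.
rewrite [X in _ = D a X + _]vec_std_deform.
rewrite [X in _ = _ + p a X]vec_eps_deform [X in X + _ = _](def_M hD).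
rewrite [X in _ + X = _]rep_M [X in _ = _ + X]rep_addr [RHS]addrCA.
exact/esym/addrA.
Qed.

Lemma deform_R r (w : VT (dual k)) :
  deform_act (gp_incl R r) w = map_mpoly (in_alg (dual k)) r *: w.
Proof.
apply: dual_vecP.
  by rewrite [LHS]vec_std_deform [LHS]rep_R; exact/esym/coef_map_mulk.
rewrite [LHS]vec_eps_deform [X in X + _](def_R hD) [LHS]add0r [LHS]rep_R.
exact/esym/coef_map_mulk.
Qed.

Lemma deform_gr (i : nat) (j : int) a (w : VT (dual k)) : ga_gr i a ->
  VR_gr (gp_wt R) j w -> VR_gr (gp_wt R) (i%:Z + j) (deform_act a w).
Proof.
move=> ha hw; rewrite /deform_act vec_pairE const_vecE.
apply: VR_gr_D; apply: coef_map_gr.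
  by apply: rep_gr => //; apply: coef_map_gr.
by apply: VR_gr_D; [apply: (def_gr hD)|apply: rep_gr] => //; apply: coef_map_gr.
Qed.

Definition deform : Rep R V (dual k) := MkRep deform_linT deform_linA
  deform_1 deform_M deform_R deform_gr.
End Theory.
End Derivations.
End Representations.

(** * Tangent vectors are first-order deformations *)

Section TangentVectors.
Variables (k : fieldType) (A : galg k) (R : gpolysub A) (V : gvect k).
Variables (O : comAlgType k) (univ : Rep R V O).
Variables (x : {lrmorphism O -> k^o}) (p : Rep R V k^o).
Hypothesis p_at_x : base_change x univ p.
Local Notation VT := (VR V (gp_n R)).
Local Notation W := (VT k^o).
Local Notation coefO := (@coef_map k V (gp_n R) O k^o).

(** A derivation of O into the residue field k at the point x. *)
Definition point_derivation (d : O -> k^o) : Prop :=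
  forall y z, d (y * z) = x y * d z + d y * x z.

(** The derivative of the universal action in the direction d, evaluated on
    vectors that are constant along the representing scheme. *)
Definition der_action (d : O -> k^o) (a : A) (v : W) : W :=
  coefO d (univ a (const_vec O v)).

Lemma coef_x_act a w : coefO x (univ a w) = p a (coefO x w).
Proof. by have := p_at_x a w; rewrite !VR_mapE => <-. Qed.

Lemma coef_x_const (v : W) : coefO x (const_vec O v) = v.
Proof.
rewrite const_vecE; apply: etrans (coef_map_comp (h := idfun) _ _) _.
  by move=> c; rewrite /= /unitk linearZ rmorph1; exact: mulr1.
exact: (@coef_map_id _ _ _ k^o idfun).
Qed.

Lemma const_vecD (T : comAlgType k) (v w : W) :
  const_vec T (v + w) = const_vec T v + const_vec T w.
Proof. by rewrite !const_vecE; exact: coef_mapD. Qed.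

Section PointDerivation.
Variables (d : {linear O -> k^o}) (hd : point_derivation d).

Lemma point_der1 : d 1 = 0.
Proof.
have := hd 1 1; rewrite !mulr1 rmorph1 mul1r mulr1 => h.
by apply: (addrI (d 1)); rewrite addr0 -h.
Qed.

Lemma point_derC (c : k) : d c%:A = 0.
Proof. by rewrite linearZ point_der1; exact: mulr0. Qed.

Lemma coef_d_const (v : W) : coefO d (const_vec O v) = 0.
Proof.
rewrite const_vecE; apply: etrans (coef_map_comp (h := \0) _ _) _.
  exact: point_derC.
exact: (@coef_map_eq0 _ _ _ k^o k^o \0).
Qed.

Lemma der_action_addr a v w :
  der_action d a (v + w) = der_action d a v + der_action d a w.
Proof. by rewrite /der_action const_vecD rep_addr; exact: coef_mapD. Qed.

Lemma coef_d_scale (c : k) w :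
  coefO d ((c%:A : O)%:MP *: w) = (c%:MP : {mpoly k[gp_n R]}) *: coefO d w.
Proof.
by apply: coef_map_scale => u; rewrite mulr_algl /= linearZ_LR.
Qed.

Lemma der_action_scaler a (c : k) (v : W) :
  der_action d a ((c%:MP : {mpoly k[gp_n R]}) *: v) =
  (c%:MP : {mpoly k[gp_n R]}) *: der_action d a v.
Proof.
have e : const_vec O ((c%:MP : {mpoly k[gp_n R]}) *: v) =
    (c%:A : O)%:MP *: const_vec O v.
  rewrite !const_vecE; apply: coef_map_scale => u.
  by rewrite [RHS]mulr_algl /= -linearZ_LR.
by rewrite /der_action e [X in coefO d X]rep_scaler; exact: coef_d_scale.
Qed.

(** The product rule for the universal action: differentiating a moving vector
    acted on by a moving operator gives one term for each. As both sides obey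
    the same rule for multiplication by elements of O, constant vectors
    suffice. *)
Lemma coef_d_act a w :
  coefO d (univ a w) = der_action d a (coefO x w) + p a (coefO d w).
Proof.
elim/VR_scalar_ext_ind: w => [|w w' hw hw'|c v].
- have e0 (f : {linear O -> k^o}) : coefO f 0 = 0 by exact: coef_map0.
  rewrite (rep_0r univ) !e0 (rep_0r p) [RHS]addr0 -[LHS](coef_d_const 0).
  rewrite /der_action; congr coefO.
  have -> : const_vec O (0 : W) = 0 by rewrite const_vecE; exact: coef_map0.
  by rewrite [RHS](rep_0r univ).
- have eD (f : {linear O -> k^o}) : coefO f (w + w') = coefO f w + coefO f w'.
    exact: coef_mapD.
  rewrite [X in coefO d X]rep_addr [LHS]coef_mapD hw hw' !eD.
  rewrite [X in _ = X + _]der_action_addr [X in _ = _ + X]rep_addr.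
  exact: addrACA.
- rewrite [X in coefO d X]rep_scaler.
  have eL w : coefO d (c%:MP *: w) =
      (x c)%:MP *: coefO d w + (d c)%:MP *: coefO x w.
    by apply: coef_map_leibniz => u; exact: hd.
  have -> : coefO x (c%:MP *: const_vec O v) = (x c)%:MP *: v.
    rewrite -[in RHS](coef_x_const v).
    by apply: coef_map_scale => u; rewrite /= rmorphM.
  rewrite [LHS]eL [X in p a X]eL coef_x_act coef_x_const coef_d_const.
  rewrite [X in p a (X + _)]scaler0 [X in _ = _ + p a X]add0r.
  by rewrite [X in _ = _ + X]rep_scaler [X in _ = X + _]der_action_scaler.
Qed.

(** Each equation is the derivative along d of the corresponding equation for
    the universal action; the product rule comes from [coef_d_act], and the
    action of R does not move because its coefficients lie in k. *)
Lemma der_action_deformation : is_deformation p (der_action d).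
Proof.
split.
- exact: der_action_addr.
- move=> c a b w; rewrite /der_action [X in coefO d X]rep_linA [LHS]coef_mapD.
  by congr (_ + _); exact: coef_d_scale.
- move=> a b w; rewrite [LHS]/der_action [X in coefO d X]rep_M [LHS]coef_d_act.
  by rewrite coef_x_act coef_x_const [LHS]addrC.
- move=> r w; rewrite /der_action [X in coefO d X]rep_R [LHS]coef_map_mulk.
  by rewrite coef_d_const; exact: scaler0.
- move=> i j a w ha hw; rewrite /der_action const_vecE.
  by apply: coef_map_gr; apply: rep_gr => //; apply: coef_map_gr.
Qed.

(** The tangent vector d as a k[eps]-valued point of Spec O over x. *)
Lemma dual_lift : exists phi : {lrmorphism O -> dual k},
  forall y, phi y = Dual (x y) (d y).
Proof.
pose f y := Dual (x y) (d y).
have fl : linear f by move=> c y z; apply: dualP; rewrite /= linearP.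
have fm : monoid_morphism f.
  split=> [|y z]; apply: dualP; rewrite /= ?rmorph1 ?point_der1 //.
  by rewrite rmorphM.
pose F := HB.pack_for {lrmorphism O -> dual k} f
  (GRing.isLinear.Build k O (dual k) *:%R f fl)
  (GRing.isMonoidMorphism.Build O (dual k) f fm).
by exists F.
Qed.

(** The structure classified by the point x + eps d is p + eps D. *)
Lemma dual_lift_base_change (phi : {lrmorphism O -> dual k}) D
    (hD : is_deformation p D) :
  (forall y, phi y = Dual (x y) (d y)) ->
  (forall a v, D a v = der_action d a v) -> base_change phi univ (deform hD).
Proof.
move=> phiE DE a w.
have re u : vec_std (VR_map phi u) = coefO x u.
  rewrite VR_mapE; apply: coef_map_comp => y.
  exact: (congr1 (@std_part k) (phiE y)).
have im u : vec_eps (VR_map phi u) = coefO d u.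
  rewrite VR_mapE; apply: coef_map_comp => y.
  exact: (congr1 (@eps_part k) (phiE y)).
apply: dual_vecP.
  by rewrite [LHS]vec_std_deform [X in p a X]re [RHS]re coef_x_act.
rewrite [LHS]vec_eps_deform [X in D a X]re [X in p a X]im [RHS]im DE.
exact/esym/coef_d_act.
Qed.
End PointDerivation.

Hypothesis univP : represents univ.

(** Two directions with the same derivative give two k[eps]-valued points that
    classify the same structure, and a classifying map is unique. *)
Lemma der_action_inj (d d' : {linear O -> k^o}) :
  point_derivation d -> point_derivation d' ->
  (forall a v, der_action d a v = der_action d' a v) -> d =1 d'.
Proof.
move=> hd hd' e.
have [phi phiE] := dual_lift hd; have [phi' phiE'] := dual_lift hd'.
have hD := der_action_deformation hd.
have [psi _ psiU] := univP (deform hD).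
have e1 : phi =1 psi.
  apply: psiU.
  exact: (dual_lift_base_change hd hD phiE (fun _ _ => erefl)).
have e2 : phi' =1 psi.
  by apply: psiU; exact: (dual_lift_base_change hd' hD phiE' e).
move=> y; have := congr1 (@eps_part k) (etrans (e1 y) (esym (e2 y))).
by rewrite phiE phiE'.
Qed.

(** The structure p + eps D over k[eps] is classified by some map out of O. Its
    reduction modulo eps classifies p, hence is x, and its eps-component is the
    derivation that is sought. *)
Lemma der_action_surj (D : A -> W -> W) : is_deformation p D ->
  exists d : {linear O -> k^o},
    point_derivation d /\ forall a v, D a v = der_action d a v.
Proof.
move=> hD; have [phi phiU _] := univP (deform hD).
have [xi _ xiU] := univP p.
have x'x : (std_part (k:=k) \o phi : {lrmorphism O -> k^o}) =1 x.
  move=> y; rewrite (xiU x) //; apply: xiU => a w.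
  have := congr1 (@vec_std k V (gp_n R)) (phiU a w).
  rewrite [X in X = _]vec_std_deform !VR_mapE.
  have re u : vec_std (coef_map phi u) = coefO (std_part (k:=k) \o phi) u.
    exact: coef_map_comp.
  move=> h; apply: etrans (etrans h (re _)).
  by congr (p a _); apply/esym/re.
exists (eps_part (k:=k) \o phi : {linear O -> k^o}); split=> [y z|a v].
  by rewrite -!x'x /= rmorphM.
have := congr1 (@vec_eps k V (gp_n R)) (phiU a (const_vec O v)).
rewrite [X in X = _]vec_eps_deform !VR_mapE.
have -> : coef_map phi (const_vec O v) = const_vec (dual k) v.
  rewrite !const_vecE; apply: coef_map_comp => c.
  by rewrite /= /unitk linearZ_LR rmorph1.
rewrite [X in D a X]vec_std_const [X in p a X]vec_eps_const (rep_0r p a).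
rewrite [X in X = _]addr0.
by move=> ->; exact: coef_map_comp.
Qed.

(** O splits as k (+) m, and a linear form on m is the same as one on O that
    vanishes on constants. *)
Lemma maxid_proj_subproof (y : O) : y - (x y)%:A \in maxid_pred x.
Proof.
by rewrite unfold_in raddfB /= linearZ_LR rmorph1 [X in _ - X]mulr1 subrr.
Qed.
Definition maxid_proj (y : O) : maxid x := MaxId (maxid_proj_subproof y).

Lemma maxid_proj_linear : linear maxid_proj.
Proof.
move=> c y z; apply: val_inj; rewrite /= linearP scalerBr scalerA.
by rewrite [in LHS]scalerDl opprD addrACA.
Qed.
HB.instance Definition _ :=
  GRing.isLinear.Build k O (maxid x) *:%R maxid_proj maxid_proj_linear.

Lemma maxid_projK (m : maxid x) : maxid_proj (maxid_val m) = m.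
Proof.
apply: val_inj; case: m => y /=; rewrite unfold_in => /eqP ->.
by rewrite scale0r subr0.
Qed.

Definition tangent_der (t : tangent x) (y : O) : k^o := t (maxid_proj y).

Lemma tangentP (t : tangent x) : is_tangent t.
Proof. by case: t => t ht; exact/asboolP. Qed.

Lemma tangent_der_linear t : linear (tangent_der t).
Proof.
by move=> c y z; rewrite /tangent_der linearP; exact: (tangentP t).1.
Qed.
HB.instance Definition _ t := GRing.isLinear.Build k O k^o *:%R
  (tangent_der t) (tangent_der_linear t).

(** With y0 = y - x(y) and z0 = z - x(z), the projection of y * z to m is
    x(y) z0 + x(z) y0 + y0 z0, and t vanishes on the last term. *)
Lemma tangent_point_der t : point_derivation (tangent_der t).
Proof.
move=> y z.
have [tl tm] := tangentP t.
have xs : maxid_val (maxid_proj y) * maxid_val (maxid_proj z) \in maxid_pred x.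
  by rewrite unfold_in rmorphM /= (eqP (maxid_proj_subproof y)) mul0r.
have e : maxid_proj (y * z) = (x y : k) *: maxid_proj z +
    ((x z : k) *: maxid_proj y + MaxId xs).
  apply: val_inj; rewrite /= rmorphM.
  rewrite mulrBl !mulrBr !mulr_algl !mulr_algr !scalerBr.
  rewrite [RHS]addrC [X in _ = X + _]addrA subrK addrC addrA subrK.
  by rewrite scalerA [X in X%:A]mulrC.
rewrite /tangent_der e tl tl (tm _ _ (MaxId xs) erefl) addr0.
by congr (_ + _); exact: mulrC.
Qed.

Definition tangent_action (t : tangent x) := der_action (tangent_der t).

Lemma tangent_action_deformation t : is_deformation p (tangent_action t).
Proof. exact: der_action_deformation (tangent_point_der t). Qed.

Lemma tangent_action_lin (c : k) (t s : tangent x) a w :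
  tangent_action (c *: t + s) a w =
  (c%:MP : {mpoly k[gp_n R]}) *: tangent_action t a w + tangent_action s a w.
Proof.
apply: VR_coefP => j m; rewrite [RHS]VR_coefD [X in _ = X + _]VR_coefC.
rewrite [LHS]coef_mapE [X in _ = _ * X + _]coef_mapE.
by rewrite [X in _ = _ + X]coef_mapE.
Qed.

Lemma tangent_action0 a w : tangent_action (0 : tangent x) a w = 0.
Proof. by apply: (coef_map_eq0 (f := tangent_der (0 : tangent x))). Qed.

Lemma tangent_action_inj (t s : tangent x) :
  (forall a w, tangent_action t a w = tangent_action s a w) -> t = s.
Proof.
move=> /(der_action_inj (tangent_point_der t) (tangent_point_der s)) e.
apply: val_inj; apply/funext => m.
by have := e (maxid_val m); rewrite /= /tangent_der maxid_projK.
Qed.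

Lemma tangent_action_surj (D : A -> W -> W) : is_deformation p D ->
  exists t : tangent x, forall a w, D a w = tangent_action t a w.
Proof.
move=> /der_action_surj[d [hd dE]].
have ht : (fun m : maxid x => d (maxid_val m)) \in tangent_pred (x := x).
  apply/asboolP; split=> [c m m'|m m' m'' e].
    by rewrite linearP.
  rewrite e hd; case: m m' {e} => y hy [z hz] /=.
  by rewrite (eqP hy) (eqP hz) mul0r mulr0 addr0.
exists (Tangent ht) => a w; rewrite dE; congr coefO; apply/funext => y.
rewrite /= /tangent_der /= linearB.
by rewrite [X in _ - X](point_derC hd) subr0.
Qed.
End TangentVectors.

(** * The degree-preserving part of an additive map *)

Section DegreeZeroPart.
Variables (k : fieldType) (A : galg k).
Implicit Types M N : gmod A.

Lemma comp_scale M (i : nat) (j : int) (a : A) (x : M) : ga_gr i a ->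
  Defs.comp (gm_grading M) (i%:Z + j) (a *: x) =
  a *: Defs.comp (gm_grading M) j x.
Proof.
move=> ha; have [s [us s0 xE]] := comp_sum (gm_grading M) x.
pose f l := Defs.comp (gm_grading M) (l - i%:Z) x.
have shiftK : cancel (fun l : int => i%:Z + l) (fun l => l - i%:Z).
  by move=> l; rewrite addrC addKr.
rewrite (@comp_uniq _ _ _ (gm_grading M) (a *: x) [seq i%:Z + l | l <- s]
  (fun l => a *: f l)).
- by rewrite /f shiftK.
- by rewrite map_inj_uniq //; exact: can_inj shiftK.
- move=> l; rewrite -[X in gm_gr X](subrK i%:Z) addrC.
  by apply: gm_act => //; exact: comp_gr.
- move=> l hl; rewrite /f s0 ?scaler0 //; apply: contra hl => hl.
  by apply/mapP; exists (l - i%:Z) => //; rewrite addrC subrK.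
- rewrite big_map {1}xE scaler_sumr; apply: eq_bigr => l _.
  by rewrite /f shiftK.
Qed.

Lemma additive_homog_ind (I : eqType) (M N : zmodType) (gr : I -> M -> Prop)
    (hgr : is_grading gr) (f g : M -> N) :
  {morph f : x y / x + y} -> {morph g : x y / x + y} ->
  (forall i x, gr i x -> f x = g x) -> f =1 g.
Proof.
move=> fD gD fg x.
have f0 : f 0 = 0 by apply: (addIr (f 0)); rewrite -fD !add0r.
have g0 : g 0 = 0 by apply: (addIr (g 0)); rewrite -gD !add0r.
have [s [_ _ ->]] := comp_sum hgr x.
rewrite (big_morph f fD f0) (big_morph g gD g0); apply: eq_bigr => i _.
by apply: (fg i); exact: comp_gr.
Qed.

(** On homogeneous elements of degree i the map is followed by the projection to
    degree i; the finite support of the decomposition of x makes the sum over i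
    finite. *)
Lemma degree0_part M N (s : M -> N) : {morph s : x y / x + y} ->
  exists s0 : M -> N, [/\ {morph s0 : x y / x + y},
    forall i x, gm_gr i x -> s0 x = Defs.comp (gm_grading N) i (s x)
    & forall i x, gm_gr i x -> gm_gr i (s0 x)].
Proof.
move=> sD; have sz : s 0 = 0 by apply: (addIr (s 0)); rewrite -sD !add0r.
pose c i x := Defs.comp (gm_grading N) i (s (Defs.comp (gm_grading M) i x)).
have cD i x y : c i (x + y) = c i x + c i y by rewrite /c compD sD compD.
have /choice[S hS] : forall x : M, exists t : seq int,
    uniq t /\ forall i, i \notin t -> c i x = 0.
  move=> x; have [t [ut t0 _]] := comp_sum (gm_grading M) x.
  by exists t; split=> // i /t0 e; rewrite /c e sz comp0.
pose s0 x := \sum_(i <- S x) c i x.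
have s0E x t : uniq t -> {subset S x <= t} -> s0 x = \sum_(i <- t) c i x.
  by move=> ut St; have [uS S0] := hS x; exact: Defs.big_sub.
have s0h i x : gm_gr i x -> s0 x = Defs.comp (gm_grading N) i (s x).
  move=> hx; rewrite (s0E x (undup (i :: S x))) ?undup_uniq //; last first.
    by move=> l hl; rewrite mem_undup inE hl orbT.
  rewrite (bigD1_seq i) ?undup_uniq ?mem_undup ?inE ?eqxx //= big1 ?addr0.
    by rewrite /c (comp_id (gm_grading M) hx).
  by move=> l hl; rewrite /c (comp_neq _ hx hl) sz comp0.
exists s0; split=> // [x y|i x hx].
  pose t := undup (S x ++ S y ++ S (x + y)).
  rewrite !(s0E _ t) ?undup_uniq // -?big_split; first by apply: eq_bigr => i _.
  - by move=> i hi; rewrite mem_undup !mem_cat hi ?orbT.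
  - by move=> i hi; rewrite mem_undup !mem_cat hi ?orbT.
  - by move=> i hi; rewrite mem_undup !mem_cat hi ?orbT.
by rewrite (s0h i) //; exact: comp_gr.
Qed.
End DegreeZeroPart.

(** * Extensions of graded modules and cocycles *)

Section Cocycles.
Variables (k : fieldType) (A : galg k) (N M : gmod A).

(** The failure of a graded additive section of an extension of N by M to be
    A-linear is such a map. *)
Record is_cocycle (D : A -> N -> M) : Prop := IsCocycle {
  coc_addl : forall a b n, D (a + b) n = D a n + D b n;
  coc_addr : forall a n n', D a (n + n') = D a n + D a n';
  coc_M : forall a b n, D (a * b) n = a *: D b n + D a (b *: n);
  coc_gr : forall (i : nat) (j : int) a n, ga_gr i a -> gm_gr j n ->
    gm_gr (i%:Z + j) (D a n) }.

Lemma cocycle0r D (hD : is_cocycle D) a : D a 0 = 0.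
Proof. by apply: (addIr (D a 0)); rewrite -(coc_addr hD) !add0r. Qed.

Lemma cocycle1 D (hD : is_cocycle D) n : D 1 n = 0.
Proof.
have := coc_M hD 1 1 n; rewrite mulr1 !scale1r => h.
by apply: (addIr (D 1 n)); rewrite add0r -h.
Qed.

Lemma coboundary_cocycle (phi : N -> M) :
  {morph phi : x y / x + y} -> (forall i n, gm_gr i n -> gm_gr i (phi n)) ->
  is_cocycle (fun a n => a *: phi n - phi (a *: n)).
Proof.
move=> phiD phigr; split=> [a b n|a n n'|a b n|i j a n ha hn].
- by rewrite !scalerDl phiD opprD addrACA.
- by rewrite !(scalerDr, phiD) opprD addrACA.
- by rewrite scalerBr !scalerA addrA subrK.
- apply: gm_B; first by apply: gm_act => //; exact: phigr.
  by apply: phigr; exact: gm_act.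
Qed.

Section Extension.
Variables (D : A -> N -> M) (hD : is_cocycle D).

(** The module structure depends on D, so the carrier, which does not, takes the
    proof about D as a parameter for the inference of instances. *)
Definition cocycle_sum of is_cocycle D : Type := (M * N)%type.
Local Notation E := (cocycle_sum hD).
HB.instance Definition _ := GRing.Zmodule.on E.

Definition cocycle_act (a : A) (e : E) : E := (a *: e.1 + D a e.2, a *: e.2).

Lemma cocycle_actA a b e :
  cocycle_act a (cocycle_act b e) = cocycle_act (a * b) e.
Proof.
by rewrite /cocycle_act /= (coc_M hD) scalerDr !scalerA addrA.
Qed.
Lemma cocycle_act1 : left_id 1 cocycle_act.
Proof. by case=> m n; rewrite /cocycle_act cocycle1 // !scale1r addr0. Qed.
Lemma cocycle_actDr : right_distributive cocycle_act +%R.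
Proof.
move=> a [m n] [m' n']; rewrite /cocycle_act /=.
by congr pair; rewrite /= ?(coc_addr hD) scalerDr // addrACA.
Qed.
Lemma cocycle_actDl e : {morph cocycle_act^~ e : a b / a + b}.
Proof.
move=> a b; rewrite /cocycle_act.
by congr pair; rewrite /= ?(coc_addl hD) scalerDl // addrACA.
Qed.
HB.instance Definition _ := GRing.Zmodule_isLmodule.Build A E
  cocycle_actA cocycle_act1 cocycle_actDr cocycle_actDl.

Lemma cocycle_gr (i : nat) (j : int) (a : A) (e : E) :
  ga_gr i a -> gprod_gr j e -> gprod_gr (i%:Z + j) (a *: e).
Proof.
move=> ha [h1 h2]; split; last exact: gm_act.
by apply: gm_D; [exact: gm_act|exact: (coc_gr hD)].
Qed.

Definition cocycle_gmod : gmod A :=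
  @GMod k A E (@gprod_gr k A M N) (gprod_grading M N) cocycle_gr.

Lemma cocycle_sum_eq (e e' : cocycle_gmod) : e.1 = e'.1 -> e.2 = e'.2 -> e = e'.
Proof. by case: e e' => m n [m' n'] /= -> ->. Qed.
Lemma cocycle_fstB (e e' : cocycle_gmod) : (e - e').1 = e.1 - e'.1.
Proof. by []. Qed.
Lemma cocycle_fstZ a (e : cocycle_gmod) : (a *: e).1 = a *: e.1 + D a e.2.
Proof. by []. Qed.

Lemma cocycle_in_subproof : is_ghom (fun m : M => (m, 0) : cocycle_gmod).
Proof.
split=> [a x y|i x hx]; last by split=> //; exact: gm_0.
congr pair; first by rewrite /= cocycle0r // addr0.
by rewrite /= scaler0 addr0.
Qed.
Definition cocycle_in : ghom M cocycle_gmod := GHom cocycle_in_subproof.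

Lemma cocycle_pr_subproof : is_ghom (fun e : cocycle_gmod => e.2 : N).
Proof. by split=> [//|i x []]. Qed.
Definition cocycle_pr : ghom cocycle_gmod N := GHom cocycle_pr_subproof.

Lemma cocycle_in_inj : injective cocycle_in.
Proof. by move=> x y []. Qed.
Lemma cocycle_pr_surj n : exists e, cocycle_pr e = n.
Proof. by exists ((0, n) : cocycle_gmod). Qed.
Lemma cocycle_exact e : cocycle_pr e = 0 <-> exists m, e = cocycle_in m.
Proof.
by case: e => m n; split=> [/= ->|[m' [_ ->]]] //; exists m.
Qed.

Definition cocycle_ext : ext N M :=
  MkExt cocycle_in_inj cocycle_pr_surj cocycle_exact.

(** A section s with defect D identifies M (+) N, with the action twisted by D,
    with the extension, by (m, n) |-> m + s n. *)
Lemma cocycle_ext_section (F : ext N M) (s : N -> F) :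
  {morph s : x y / x + y} -> (forall i n, gm_gr i n -> gm_gr i (s n)) ->
  (forall n, ex_pr F (s n) = n) ->
  (forall a n, a *: s n = s (a *: n) + ex_in F (D a n)) ->
  ext_eqv cocycle_ext F.
Proof.
move=> sD sgr prs sact.
have hphi : is_ghom (fun e : cocycle_ext => ex_in F e.1 + s e.2 : F).
  split=> [a [m n] [m' n']|i [m n] [h1 h2]] /=.
    rewrite sD !ghomD ghomZ scalerDr sact.
    rewrite addrACA -[X in X + _ = _]addrA; congr (_ + _ + _).
    exact: addrC.
  by apply: gm_D; [exact: ghom_gr|exact: sgr].
exists (GHom hphi); split=> [m|[m n]] /=.
  by rewrite (_ : s 0 = 0) ?addr0 //; apply: (addIr (s 0)); rewrite -sD !add0r.
by rewrite ghomD ex_pr_in add0r prs.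
Qed.

(** Splittings have the form n |-> (phi n, n), and A-linearity of such a map
    says that D is the commutator with phi. *)
Lemma cocycle_ext_split : ext_eqv cocycle_ext (ext_split N M) <->
  exists phi : N -> M, [/\ {morph phi : x y / x + y},
    forall i n, gm_gr i n -> gm_gr i (phi n)
    & forall a n, D a n = a *: phi n - phi (a *: n)].
Proof.
split=> [[f [fin fpr]]|[phi [phiD phigr DE]]]; last first.
  apply: (@cocycle_ext_section (ext_split N M) (fun n => (phi n, n))).
  - by move=> x y; rewrite phiD.
  - by move=> i n hn; split=> //; exact: phigr.
  - by [].
  - by move=> a n; congr pair; rewrite /= ?addr0 // DE addrC subrK.
pose s n : cocycle_gmod := (0, n).
exists (fun n => (f (s n)).1); split=> [x y|i n hn|a n].
- have -> : s (x + y) = s x + s y by congr pair; rewrite /= addr0.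
  by rewrite ghomD.
- have /(ghom_gr f)[//] : gm_gr i (s n) by split=> //; exact: gm_0.
- have e : a *: s n = cocycle_in (D a n) + s (a *: n).
    by congr pair; rewrite /= ?scaler0 ?add0r ?addr0.
  have := ghomZ f a (s n); rewrite e ghomD fin => /(congr1 fst) /= <-.
  by rewrite addrK.
Qed.
End Extension.

(** The defect a *: s n - s (a *: n) dies in N, hence comes from M; the cocycle
    identities hold because they hold after the injection of M. *)
Lemma section_cocycle (F : ext N M) (s : N -> F) :
  {morph s : x y / x + y} -> (forall i n, gm_gr i n -> gm_gr i (s n)) ->
  (forall n, ex_pr F (s n) = n) ->
  exists2 D, is_cocycle D &
    forall a n, a *: s n = s (a *: n) + ex_in F (D a n).
Proof.
move=> sD sgr prs.
have /choice[D0 hD0] : forall an : A * N, exists m,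
    an.1 *: s an.2 - s (an.1 *: an.2) = ex_in F m.
  by case=> a n; apply/ex_exact; rewrite /= ghomB ghomZ !prs subrr.
pose D a n := D0 (a, n).
have DE a n : ex_in F (D a n) = a *: s n - s (a *: n).
  by rewrite -(hD0 (a, n)).
exists D; last by move=> a n; rewrite DE addrC subrK.
split.
- move=> a b n; apply: (@ex_inj _ _ _ _ F); rewrite ghomD !DE.
  by rewrite !scalerDl sD opprD addrACA.
- move=> a n n'; apply: (@ex_inj _ _ _ _ F); rewrite ghomD !DE.
  by rewrite !(scalerDr, sD) opprD addrACA.
- move=> a b n; apply: (@ex_inj _ _ _ _ F); rewrite ghomD ghomZ !DE.
  by rewrite scalerBr !scalerA addrA subrK.
- move=> i j a n ha hn.
  rewrite -[D a n](_ : Defs.comp (gm_grading M) (i%:Z + j) (D a n) = _).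
    exact: comp_gr.
  apply: (@ex_inj _ _ _ _ F); rewrite -ghom_comp DE comp_id //.
  apply: gm_B; first by apply: gm_act => //; exact: sgr.
  by apply: sgr; exact: gm_act.
Qed.

(** A scalar commutes with a, so the cocycle identity can be applied to the
    product in both orders. *)
Lemma cocycle_algZ D (hD : is_cocycle D) (c : k) a n :
  (forall n', D c%:A n' = 0) ->
  D a ((c%:A : A) *: n) = (c%:A : A) *: D a n.
Proof.
move=> D0; have := coc_M hD a c%:A n; rewrite D0 scaler0 add0r => <-.
by rewrite mulr_algr -(mulr_algl c a) (coc_M hD) D0 addr0.
Qed.

(** In the Baer sum of c.E and E', the class of the pair of ((0, c n), n) and
    (0, n) is a section, and its defect is c D + D'. *)
Lemma cocycle_ext_lin (c : k) D D' D'' (hD : is_cocycle D)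
    (hD' : is_cocycle D') (hD'' : is_cocycle D'') :
  (forall n, D c%:A n = 0) ->
  (forall a n, D'' a n = (c%:A : A) *: D a n + D' a n) ->
  ext_eqv (cocycle_ext hD'')
    (baer_sum (ext_scale c (cocycle_ext hD)) (cocycle_ext hD')).
Proof.
move=> D0 DE; pose E := cocycle_ext hD; pose E' := cocycle_ext hD'.
pose Ec := ext_scale c E.
pose u n : Ec := @gpb_mk _ _ _ _ _ (ex_pr E) (c *: ghom_id N)
  ((0, (c%:A : A) *: n) : E) n erefl.
pose v n : gpb (ex_pr Ec) (ex_pr E') :=
  @gpb_mk _ _ _ _ _ (ex_pr Ec) (ex_pr E') (u n) ((0, n) : E') erefl.
have uD : {morph u : n n' / n + n'}.
  move=> n n'; apply: gpb_inj => //.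
  by congr pair; rewrite /= ?addr0 // scalerDr.
have vD : {morph v : n n' / n + n'}.
  move=> n n'; apply: gpb_inj; first exact: uD.
  by congr pair; rewrite /= addr0.
apply: (@cocycle_ext_section D'' hD'' (baer_sum Ec E')
  (fun n => baer_pi Ec E' (v n))).
- move=> n n'.
  exact: etrans (congr1 (baer_pi Ec E') (vD n n')) (ghomD _ _ _).
- move=> i n hn; apply: ghom_gr; split=> /=; last by split=> //; exact: gm_0.
  by split=> //=; split; [exact: gm_0|exact: gm_Z].
- by move=> n; rewrite [LHS]baer_prE.
- move=> a n; apply/eqP; rewrite addrC -subr_eq; apply/eqP.
  rewrite -[X in X - _]ghomZ -[LHS]ghomB; apply/baer_inE.
  exists ((c%:A : A) *: D a n), (D' a n); split.
  + apply/ext_scale_inE; split; last first.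
      by rewrite [LHS]ghomB [X in X - _]ghomZ; exact: subrr.
    rewrite [LHS]ghomB [X in X - _]ghomZ.
    have -> : ext_scale_pr1 c E (u n) = ((0, (c%:A : A) *: n) : E) by [].
    have -> : ext_scale_pr1 c E (u (a *: n)) =
      ((0, (c%:A : A) *: (a *: n)) : E) by [].
    apply: cocycle_sum_eq.
      rewrite cocycle_fstB cocycle_fstZ /= scaler0 add0r subr0.
      exact: cocycle_algZ.
    by rewrite [LHS](ghomB (cocycle_pr hD)) ghomZ /= algZ_comm subrr.
  + rewrite [LHS]ghomB [X in X - _]ghomZ.
    apply: cocycle_sum_eq.
      by rewrite cocycle_fstB cocycle_fstZ /= scaler0 add0r subr0.
    by rewrite [LHS](ghomB (cocycle_pr hD')) ghomZ /= subrr.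
  + exact: DE.
Qed.
End Cocycles.

(** * Extensions of a graded module that is free over R *)

Section GradedFreeness.
Variables (k : fieldType) (A : galg k) (R : gpolysub A).
Local Notation RR := {mpoly k[gp_n R]}.

(** For monomials this is the choice of the weights of the variables. *)
Lemma gp_incl_gr j (r : RR) : whom (gp_wt R) j r -> ga_gr j (gp_incl R r).
Proof.
move=> hr; rewrite (mpolyE r) raddf_sum big_seq.
have hgr := ga_grading A.
elim/big_rec: _ => [|m y /hr <- hy]; first exact: (gr_0 hgr).
apply: (gr_D hgr) => //; rewrite /= linearZ_LR; apply: ga_Z.
rewrite mpolyXE_id rmorph_prod /wdeg.
elim/big_rec2: _ => [|i b d _ hb]; first exact: ga_1.
apply: ga_M => //; rewrite /= rmorphXn; have hi := gp_homog i.
elim: (m i) => [|l hl]; first by rewrite muln0; exact: ga_1.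
by rewrite exprS mulnS; exact: ga_M.
Qed.

Variables (V : gvect k) (p : Rep R V k^o).
Local Notation W := (VR V (gp_n R) k^o).

Lemma Mp_mulR (r : RR) (w : Mp p) : gp_incl R r *: w = (r *: (w : W) : W).
Proof. by rewrite -[LHS]/(p (gp_incl R r) w) rep_R map_mpoly_in_alg_k. Qed.

Lemma Mp_algZ (c : k) (w : Mp p) :
  (c%:A : A) *: w = ((c%:MP : RR) *: (w : W) : W).
Proof.
by rewrite -Mp_mulR -alg_mpolyC linearZ_LR rmorph1.
Qed.

(** The module is free over R, so lifts of the basis vectors define an R-linear
    section. Its degree-preserving part is still a section, as the projection
    preserves degrees, and still R-linear, as R is spanned by homogeneous
    elements. *)
Lemma Mp_R_section (M : gmod A) (F : ext (Mp p) M) :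
  exists s : Mp p -> F, [/\ {morph s : x y / x + y},
    forall i w, gm_gr i w -> gm_gr i (s w),
    forall w, ex_pr F (s w) = w
    & forall r w, s (gp_incl R r *: w) = gp_incl R r *: s w].
Proof.
pose b j : Mp p := (delta_mx 0 j : W).
have /choice[e he] : forall j, exists e, ex_pr F e = b j.
  by move=> j; exact: ex_surj.
pose s (w : Mp p) : F := \sum_j gp_incl R ((w : W) 0 j) *: e j.
have sD : {morph s : w w' / w + w'}.
  move=> w w'; rewrite -big_split; apply: eq_bigr => j _.
  by rewrite mxE rmorphD scalerDl.
have sR r w : s (gp_incl R r *: w) = gp_incl R r *: s w.
  rewrite scaler_sumr; apply: eq_bigr => j _.
  by rewrite Mp_mulR mxE rmorphM scalerA.
have prs w : ex_pr F (s w) = w.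
  rewrite (big_morph _ (ghomD (ex_pr F)) (ghom0 (ex_pr F))).
  rewrite [RHS](row_sum_delta (w : W)); apply: eq_bigr => j _.
  by rewrite ghomZ he Mp_mulR.
have [s0 [s0D s0h s0gr]] := degree0_part sD.
exists s0; split=> // [w|r w].
  apply: (additive_homog_ind (gm_grading (Mp p))
    (f := fun w => ex_pr F (s0 w)) (g := id)) => //.
    by move=> x y; rewrite s0D ghomD.
  by move=> i x hx; rewrite (s0h i) // -ghom_comp prs comp_id.
have h (r' : RR) : s0 (gp_incl R r' *: w) = gp_incl R r' *: s0 w.
  apply: (additive_homog_ind (gm_grading (Mp p))
    (f := fun w => s0 (gp_incl R r' *: w))
    (g := fun w => gp_incl R r' *: s0 w)).
  - by move=> x y; rewrite scalerDr s0D.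
  - by move=> x y; rewrite s0D scalerDr.
  move=> j x hx.
  apply: (additive_homog_ind (whom_grading (gp_wt R) k)
    (f := fun r => s0 (gp_incl R r *: x)) (g := fun r => gp_incl R r *: s0 x)).
  - by move=> a b'; rewrite rmorphD scalerDl s0D.
  - by move=> a b'; rewrite rmorphD scalerDl.
  move=> i a /gp_incl_gr ha.
  rewrite (s0h (i%:Z + j)) ?(s0h j) //; first by rewrite sR comp_scale.
  exact: gm_act.
exact: h.
Qed.

(** A first-order deformation is a cocycle of M_p with values in M_p that kills
    R: linearity over k then follows from k being contained in R. *)
Lemma deformation_cocycle (D : A -> W -> W) : is_deformation p D <->
  @is_cocycle k A (Mp p) (Mp p) D /\ forall r w, D (gp_incl R r) w = 0.
Proof.
split=> [hD|[hD DR]].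
  split; last exact: (def_R hD).
  split; [|exact: (def_addr hD)| |exact: (def_gr hD)].
    move=> a b w; have := def_linA hD 1 a b w.
    by rewrite scale1r mpolyC1 scale1r.
  exact: (def_M hD).
have DC c w : D c%:A w = 0.
  by rewrite -(rmorph1 (gp_incl R)) -linearZ_LR DR.
split=> //; [exact: (coc_addr hD)| |exact: (coc_M hD)|exact: (coc_gr hD)].
move=> c a b w; rewrite [LHS](coc_addl hD) -(mulr_algl c a).
rewrite [X in X + _ = _](coc_M hD) DC addr0.
by rewrite [X in X + _ = _]Mp_algZ.
Qed.
End GradedFreeness.

(** * The five-term exact sequence *)

Section FiveTermSequence.
Variables (k : fieldType) (A : galg k) (R : gpolysub A) (V : gvect k).
Variables (O : comAlgType k) (univ : Rep R V O).
Variables (x : {lrmorphism O -> k^o}) (p : Rep R V k^o).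
Hypothesis univP : represents univ.
Hypothesis p_at_x : base_change x univ p.
Local Notation RR := {mpoly k[gp_n R]}.
Local Notation W := (VR V (gp_n R) k^o).
Local Notation M := (Mp p).
Local Notation F := (VR_gmod V (gp_wt R)).

Lemma restrict_subproof (f : ghom M M) : @is_ghom k _ F F f.
Proof.
split=> [r v w|i w]; last exact: (@ghom_gr _ _ _ _ f).
have e : f ((r *: (v : W) : W) : M) = (r *: (f v : W) : W).
  by rewrite -!Mp_mulR ghomZ.
exact: etrans (ghomD f _ _) (congr1 (fun z : M => z + f w) e).
Qed.
Definition restrict (f : ghom M M) : ghom F F := GHom (restrict_subproof f).

Lemma restrict_linear : linear restrict.
Proof.
move=> c f f'; apply: ghom_ext => w.
rewrite -[LHS]/((c%:A : A) *: f w + f' w : M) [X in X + _ = _]Mp_algZ.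
by rewrite -alg_mpolyC.
Qed.

(** The infinitesimal change of p under conjugation by 1 - eps phi. *)
Definition commutator (phi : ghom F F) (a : A) (w : W) : W :=
  p a (phi w) - phi (p a w).

Lemma commutator_deformation phi : is_deformation p (commutator phi).
Proof.
apply/deformation_cocycle; split.
  apply: (@coboundary_cocycle _ _ M M phi); first exact: (ghomD phi).
  exact: (@ghom_gr _ _ _ _ phi).
move=> r w; rewrite /commutator !(rep_R p) !map_mpoly_in_alg_k.
by rewrite [X in _ - X](ghomZ phi) subrr.
Qed.

Lemma commutator_lin (c : k) (phi psi : ghom F F) a w :
  commutator (c *: phi + psi) a w =
  (c%:MP : RR) *: commutator phi a w + commutator psi a w.
Proof.
have e v : (c *: phi + psi) v = (c%:MP : RR) *: (phi v : W) + psi v :> W.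
  by rewrite -alg_mpolyC.
rewrite /commutator !e [X in X - _](rep_addr p) [X in X + _ - _](rep_mulR p).
by rewrite scalerBr opprD addrACA.
Qed.

Lemma tangent_cocycle (t : tangent x) :
  @is_cocycle k A M M (tangent_action univ t).
Proof.
by have /deformation_cocycle[] := tangent_action_deformation p_at_x t.
Qed.

Lemma tangent_action_algC (t : tangent x) (c : k) w :
  tangent_action univ t c%:A w = 0.
Proof.
rewrite -(rmorph1 (gp_incl R)) -linearZ_LR.
exact: (def_R (tangent_action_deformation p_at_x t)).
Qed.

Lemma commutator_eq0 (phi : ghom F F) :
  (forall a w, commutator phi a w = 0) <-> exists psi, phi = restrict psi.
Proof.
split=> [comm0|[psi ->] a w]; last first.
  rewrite -[LHS]/(a *: psi w - psi (a *: (w : M)) : M).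
  by rewrite [X in _ - X]ghomZ subrr.
have comm a w : p a (phi w) = phi (p a w).
  by apply/eqP; rewrite -subr_eq0; apply/eqP; exact: comm0.
have hphi : @is_ghom k A M M phi.
  split=> [a v w|i w]; last exact: (ghom_gr phi).
  by apply: etrans (ghomD phi _ _) _; rewrite -comm.
by exists (GHom hphi); apply: ghom_ext.
Qed.

Definition tangent_ext (t : tangent x) : Ext1 M M :=
  ext_cls (cocycle_ext (tangent_cocycle t)).

Lemma tangent_ext_linear : bv_linear tangent_ext.
Proof.
move=> c t s.
rewrite -[RHS]/(Ext1_D (Ext1_Z c (tangent_ext t)) (tangent_ext s)).
rewrite Ext1_ZE Ext1_DE.
apply/ext_clsP; apply: cocycle_ext_lin => [n|a n].
  exact: tangent_action_algC.
by rewrite tangent_action_lin [X in _ = X + _]Mp_algZ.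
Qed.

(** A splitting of the extension is a map phi of which the deformation is the
    commutator; as the deformation kills R, phi is R-linear. *)
Lemma tangent_ext_eq0 (t : tangent x) : tangent_ext t = bv0 (Ext1 M M) <->
  exists phi : ghom F F,
    forall a w, tangent_action univ t a w = commutator phi a w.
Proof.
split=> [/ext_clsP /cocycle_ext_split[phi [phiD phigr phiE]]|[phi phiE]].
  have hphi : @is_ghom k _ F F phi.
    split=> [r v w|i w]; last exact: phigr.
    apply: etrans (phiD _ _) _; congr (_ + _).
    have := phiE (gp_incl R r) v.
    rewrite (def_R (tangent_action_deformation p_at_x t)) !Mp_mulR.
    by move/esym/eqP; rewrite subr_eq0 => /eqP <-.
  by exists (GHom hphi) => a w; rewrite phiE.
apply/ext_clsP/cocycle_ext_split; exists phi; split.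
- exact: (ghomD phi).
- by move=> i n; exact: (ghom_gr phi).
- exact: phiE.
Qed.

(** An R-linear section exists, so the cocycle it defines kills R and is
    therefore a first-order deformation of p. *)
Lemma tangent_ext_surj (C : Ext1 M M) : exists t, tangent_ext t = C.
Proof.
have [E <-] := ext_cls_surj C.
have [s [sD sgr prs sR]] := Mp_R_section E.
have [D hD DE] := section_cocycle sD sgr prs.
have hdef : is_deformation p D.
  apply/deformation_cocycle; split=> // r v.
  apply: (@ex_inj _ _ _ _ E); rewrite ghom0.
  have := DE (gp_incl R r) v; rewrite sR => /eqP.
  by rewrite -subr_eq0 opprD addrA subrr sub0r oppr_eq0 => /eqP.
have [t tE] := tangent_action_surj p_at_x univP hdef.
exists t; apply/ext_clsP; apply: cocycle_ext_section sD sgr prs _.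
by move=> a n; rewrite DE tE.
Qed.

(** Commutators with phi are deformations, hence tangent vectors, and this is
    the middle map. It is linear because a tangent vector is determined by its
    deformation, and its kernel consists of the phi that commute with A. *)
Lemma five_term : exists (f : {linear ghom M M -> ghom F F})
    (g : {linear ghom F F -> tangent x}) (h : tangent x -> Ext1 M M),
  bv_linear h /\ exact5 f g h.
Proof.
have /choice[gt gtE] : forall phi, exists t : tangent x,
    forall a w, commutator phi a w = tangent_action univ t a w.
  move=> phi; apply: (tangent_action_surj p_at_x univP).
  exact: commutator_deformation.
have gt_lin : linear gt.
  move=> c phi psi; apply: (tangent_action_inj p_at_x univP) => a w.
  by rewrite tangent_action_lin -!gtE commutator_lin.
pose f : {linear ghom M M -> ghom F F} := HB.pack_for
  {linear ghom M M -> ghom F F} restrict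
  (GRing.isLinear.Build k _ _ *:%R restrict restrict_linear).
pose g : {linear ghom F F -> tangent x} := HB.pack_for
  {linear ghom F F -> tangent x} gt
  (GRing.isLinear.Build k _ _ *:%R gt gt_lin).
exists f, g, tangent_ext; split; first exact: tangent_ext_linear.
split.
- move=> u v /(congr1 (@gfun _ _ _ _)) uv; apply: ghom_ext => w.
  exact: (congr1 (fun q => q w) uv).
- move=> phi; split=> [g0|/commutator_eq0 phi0].
    apply/commutator_eq0 => a w; rewrite gtE -[gt phi]/(g phi) g0.
    exact: tangent_action0.
  apply: (tangent_action_inj p_at_x univP) => a w.
  by rewrite tangent_action0 -gtE phi0.
- move=> t; split=> [/tangent_ext_eq0[phi phiE]|[phi ->]].
    exists phi; apply: (tangent_action_inj p_at_x univP) => a w.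
    by rewrite phiE gtE.
  by apply/tangent_ext_eq0; exists phi => a w; rewrite gtE.
- exact: tangent_ext_surj.
Qed.
End FiveTermSequence.

Theorem proposition2p3 (k : closedFieldType)
  (A : galg k)
  (A_finite_center : module_finite (fun z : A => central z))
  (center_fg : fg_center A)
  (A0_findim : finite_dim (fun a : A => ga_gr 0%N a))
  (R : gpolysub A)
  (A_finite_R : module_finite (gp_mem R))
  (V : gvect k)
  (O : comAlgType k)
  (O_fg : fg_algebra O)
  (univ : Rep R V O)
  (O_represents : represents univ)
  (x : {lrmorphism O -> k^o})
  (p : Rep R V k^o)
  (p_at_x : base_change x univ p) :
  exists (f : {linear ghom (Mp p) (Mp p) ->
                      ghom (VR_gmod V (gp_wt R)) (VR_gmod V (gp_wt R))})
         (g : {linear ghom (VR_gmod V (gp_wt R)) (VR_gmod V (gp_wt R)) ->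
                      tangent x})
         (h : tangent x -> Ext1 (Mp p) (Mp p)),
    bv_linear h /\ exact5 f g h.
Proof. exact: (five_term O_represents p_at_x). Qed.
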